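(* Let $(A,G,\alpha)$ be a $C^*$-dynamical system with $G$ a locally compact abelian group. Let $a$, $b$, and $c$ be $\alpha$-integrable elements of $A$. (i) If $a\stackrel{rc}{\sim}c$ and $b\stackrel{rc}{\sim}c$ then $a+b\stackrel{rc}{\sim}c$. (ii) If $a\stackrel{rc}{\sim}b$ then $b^*\stackrel{rc}{\sim}a^*$. (iii) If $a\stackrel{rc}{\sim}b$ then for every $w\in\widehat G$ and every $m\in M_w(A)$ one has that both $ma\stackrel{rc}{\sim}b$ and $a\stackrel{rc}{\sim}bm$. (iv) If $a\stackrel{rc}{\sim}c$ and $c\stackrel{rc}{\sim}b$ then for every $w\in\widehat G$ we have that $aE_w(c)\stackrel{rc}{\sim}b$ and $a\stackrel{rc}{\sim}E_w(c)b$.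
   Context: $\alpha$ is a strongly continuous action of $G$ (with fixed Haar measure $dt$ and Pontryagin dual $\widehat G$) on the $C^*$-algebra $A$, extended to the multiplier algebra $M(A)$. Write $\langle x,t\rangle$ for the duality between $x\in\widehat G$ and $t\in G$. For $x\in\widehat G$, $M_x(A)=\{m\in M(A):\alpha_t(m)=\overline{\langle x,t\rangle}\,m,\ t\in G\}$. Integrability: a function $f:G\to A$ is unconditionally integrable if it is Bochner integrable over every relatively compact (measurable) $K\subseteq G$ and the net $\{\int_K f(t)\,dt\}_K$, indexed by the relatively compact subsets ordered by inclusion, converges in norm; the limit is denoted $\int^u_G f(t)\,dt$. An element $a\in A$ is $\alpha$-integrable if for every $b\in A$ the functions $t\mapsto \alpha_t(a)b$ and $t\mapsto b\,\alpha_t(a)$ are unconditionally integrable. Fourier coefficients: for $a$ $\alpha$-integrable and $x\in\widehat G$, $E_x(a)$ is the element of $M(A)$ (in fact of $M_x(A)$) determined by $E_x(a)b=\int^u_G\langle x,t\rangle\alpha_t(a)b\,dt$ and $bE_x(a)=\int^u_G\langle x,t\rangle b\,\alpha_t(a)\,dt$ for $b\in A$. Relative continuity: for $\alpha$-integrable $a,b$ write $a\stackrel{rc}{\sim}b$ if $\|E_{xz}(a)E_y(b)-E_x(a)E_{zy}(b)\|\to0$ as $z\to e$ in $\widehat G$, uniformly in $x,y\in\widehat G$. (It is part of the assertions that the elements being related are $\alpha$-integrable.) *)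

(* Defs.v *)
From HB Require Import structures.
From mathcomp Require Import all_boot all_order all_algebra.
From mathcomp Require Import all_classical all_reals all_analysis.
From mathcomp Require Export complex.

Set Implicit Arguments.
Unset Strict Implicit.
Unset Printing Implicit Defensive.

Import Order.TTheory GRing.Theory Num.Theory.
Import numFieldNormedType.Exports.

Local Open Scope classical_set_scope.
Local Open Scope complex_scope.
Local Open Scope ring_scope.

(** * C*-algebras *)

(* A need not be unital, hence is not a pzRingType: the product is cmul. *)
HB.mixin Record CompleteNormedModule_isCStarAlgebra (R : realType) A
    & CompleteNormedModule R[i] A := {
  cmul : A -> A -> A ;
  star : A -> A ;
  cmulA : associative cmul ;
  cmulDl : left_distributive cmul +%R ;
  cmulDr : right_distributive cmul +%R ;
  cmulZl : forall (k : R[i]) (a b : A), cmul (k *: a) b = k *: cmul a b ;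
  cmulZr : forall (k : R[i]) (a b : A), cmul a (k *: b) = k *: cmul a b ;
  norm_cmul_le : forall a b : A, `|cmul a b| <= `|a| * `|b| ;
  starK : involutive star ;
  starD : {morph star : a b / a + b} ;
  starZ : forall (k : R[i]) (a : A), star (k *: a) = k^* *: star a ;
  starM : forall a b : A, star (cmul a b) = cmul (star b) (star a) ;
  cstar_identity : forall a : A, `|cmul (star a) a| = `|a| ^+ 2
}.

#[short(type="cstarAlgType")]
HB.structure Definition CStarAlgebra (R : realType) :=
  {A of CompleteNormedModule R[i] A & CompleteNormedModule_isCStarAlgebra R A}.

Notation "a ** b" := (cmul a b) (at level 40, left associativity) : ring_scope.

(* The norm of a normed module over R[i] takes its values in R[i]. *)
Definition rnorm (R : realType) (V : normedModType R[i]) (v : V) : R :=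
  complex.Re `|v|.

(** * The multiplier algebra *)

(* M(A) as the algebra of double centralizers (Busby): lmulm m b is m b and
   rmulm m a is a m.  Linearity, boundedness, m (a b) = (m a) b and
   (a b) m = a (b m) follow from multiplierP. *)
Record multiplier (R : realType) (A : cstarAlgType R) := Multiplier {
  lmulm : A -> A ;
  rmulm : A -> A ;
  multiplierP : forall a b : A, a ** lmulm b = rmulm a ** b
}.

HB.instance Definition _ (R : realType) (A : cstarAlgType R) :=
  gen_eqMixin (multiplier A).
HB.instance Definition _ (R : realType) (A : cstarAlgType R) :=
  gen_choiceMixin (multiplier A).

Section multiplier_algebra.
Variables (R : realType) (A : cstarAlgType R).
Implicit Types (a b : A) (m n : multiplier A).

Lemma multiplier_eqP m n :
  lmulm m =1 lmulm n -> rmulm m =1 rmulm n -> m = n.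
Proof.
case: m n => [l r p] [l' r' p'] /= /funext el /funext er.
by subst l' r'; congr Multiplier; exact: Prop_irrelevance.
Qed.

Lemma cmul0l a : 0 ** a = 0.
Proof. by apply: (addrI (0 ** a)); rewrite -cmulDl !addr0. Qed.

Lemma cmul0r a : a ** 0 = 0.
Proof. by apply: (addrI (a ** 0)); rewrite -cmulDr !addr0. Qed.

Lemma cmulNl a b : (- a) ** b = - (a ** b).
Proof. by rewrite -scaleN1r cmulZl scaleN1r. Qed.

Lemma cmulNr a b : a ** (- b) = - (a ** b).
Proof. by rewrite -scaleN1r cmulZr scaleN1r. Qed.

Fact mzero_subproof a b : a ** 0 = 0 ** b.
Proof. by rewrite cmul0l cmul0r. Qed.

Definition mzero := Multiplier mzero_subproof.

Fact madd_subproof m n a b :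
  a ** (lmulm m b + lmulm n b) = (rmulm m a + rmulm n a) ** b.
Proof. by rewrite cmulDl cmulDr !multiplierP. Qed.

Definition madd m n := Multiplier (madd_subproof m n).

Fact mopp_subproof m a b : a ** (- lmulm m b) = (- rmulm m a) ** b.
Proof. by rewrite cmulNl cmulNr multiplierP. Qed.

Definition mopp m := Multiplier (mopp_subproof m).

Fact mscale_subproof (k : R[i]) m a b :
  a ** (k *: lmulm m b) = (k *: rmulm m a) ** b.
Proof. by rewrite cmulZl cmulZr multiplierP. Qed.

Definition mscale (k : R[i]) m := Multiplier (mscale_subproof k m).

Fact mmul_subproof m n a b :
  a ** lmulm m (lmulm n b) = rmulm n (rmulm m a) ** b.
Proof. by rewrite !multiplierP. Qed.

Definition mmul m n := Multiplier (mmul_subproof m n).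

Fact maddA : associative madd.
Proof. by move=> m n p; apply: multiplier_eqP => a /=; rewrite addrA. Qed.

Fact maddC : commutative madd.
Proof. by move=> m n; apply: multiplier_eqP => a /=; rewrite addrC. Qed.

Fact madd0 : left_id mzero madd.
Proof. by move=> m; apply: multiplier_eqP => a /=; rewrite add0r. Qed.

Fact maddN : left_inverse mzero mopp madd.
Proof. by move=> m; apply: multiplier_eqP => a /=; rewrite addNr. Qed.

HB.instance Definition _ :=
  GRing.isZmodule.Build (multiplier A) maddA maddC madd0 maddN.

Fact mscaleA (k l : R[i]) m : mscale k (mscale l m) = mscale (k * l) m.
Proof. by apply: multiplier_eqP => a /=; rewrite scalerA. Qed.

Fact mscale1 : left_id 1 mscale.
Proof. by move=> m; apply: multiplier_eqP => a /=; rewrite scale1r. Qed.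

Fact mscaleDr : right_distributive mscale +%R.
Proof. by move=> k m n; apply: multiplier_eqP => a /=; rewrite scalerDr. Qed.

Fact mscaleDl m : {morph mscale^~ m : k l / k + l}.
Proof. by move=> k l; apply: multiplier_eqP => a /=; rewrite scalerDl. Qed.

HB.instance Definition _ := GRing.Zmodule_isLmodule.Build R[i] (multiplier A)
  mscaleA mscale1 mscaleDr mscaleDl.

(* The operator norm; extended-real valued so that no bound has to be supplied
   to form it. *)
Definition mnorm m : \bar R :=
  ereal_sup [set (rnorm (lmulm m b))%:E | b in [set b : A | `|b| <= 1]].

End multiplier_algebra.

(** * The dual group *)

Record dual (R : realType) (G : topologicalZmodType) := Character {
  pairing :> G -> R[i] ;
  pairing_norm : forall t, `|pairing t| = 1 ;
  pairingD : forall s t, pairing (s + t) = pairing s * pairing t ;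
  pairing_continuous : continuous (pairing : G -> R[i]^o)
}.

HB.instance Definition _ (R : realType) (G : topologicalZmodType) :=
  gen_eqMixin (dual R G).
HB.instance Definition _ (R : realType) (G : topologicalZmodType) :=
  gen_choiceMixin (dual R G).

(* The dual is written additively, as is G: the product xz of characters is
   x + z and the trivial character is 0. *)
Section dual_group.
Variables (R : realType) (G : topologicalZmodType).
Implicit Types (x y : dual R G).

Lemma dual_eqP x y : x =1 y -> x = y.
Proof.
case: x y => [f a b c] [g a' b' c'] /= /funext efg; subst g.
by congr Character; exact: Prop_irrelevance.
Qed.

Fact dual0_norm (t : G) : `|1 : R[i]| = 1.
Proof. exact: normr1. Qed.

Fact dual0D (s t : G) : 1 = 1 * 1 :> R[i].
Proof. by rewrite mulr1. Qed.

Fact dual0_continuous : continuous (fun _ : G => (1 : R[i]^o)).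
Proof. by move=> t; exact: cvg_cst. Qed.

Definition dual0 : dual R G := Character dual0_norm dual0D dual0_continuous.

Fact dual_add_norm x y t : `|x t * y t| = 1.
Proof. by rewrite normrM !pairing_norm mulr1. Qed.

Fact dual_addD x y s t : x (s + t) * y (s + t) = x s * y s * (x t * y t).
Proof. by rewrite !pairingD mulrACA. Qed.

Fact dual_add_continuous x y : continuous (fun t => x t * y t : R[i]^o).
Proof.
move=> t; apply: (@cvgM _ _ _ _ (x : G -> R[i]^o) (y : G -> R[i]^o));
  exact: pairing_continuous.
Qed.

Definition dual_add x y : dual R G :=
  Character (dual_add_norm x y) (@dual_addD x y) (@dual_add_continuous x y).

Fact dual_opp_norm x t : `|(x t)^-1| = 1.
Proof. by rewrite normfV pairing_norm invr1. Qed.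

Fact dual_oppD x s t : (x (s + t))^-1 = (x s)^-1 * (x t)^-1.
Proof. by rewrite pairingD invfM. Qed.

Fact pairing_neq0 x t : x t != 0.
Proof. by rewrite -normr_eq0 pairing_norm oner_eq0. Qed.

Fact dual_opp_continuous x : continuous (fun t => (x t)^-1 : R[i]^o).
Proof.
move=> t; apply: (@cvgV _ _ _ _ (x : G -> R[i]^o)).
  exact: pairing_neq0.
exact: pairing_continuous.
Qed.

Definition dual_opp x : dual R G :=
  Character (dual_opp_norm x) (@dual_oppD x) (@dual_opp_continuous x).

Fact dual_addA : associative dual_add.
Proof. by move=> x y z; apply: dual_eqP => t /=; rewrite mulrA. Qed.

Fact dual_addC : commutative dual_add.
Proof. by move=> x y; apply: dual_eqP => t /=; rewrite mulrC. Qed.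

Fact dual_add0 : left_id dual0 dual_add.
Proof. by move=> x; apply: dual_eqP => t /=; rewrite mul1r. Qed.

Fact dual_addN : left_inverse dual0 dual_opp dual_add.
Proof.
by move=> x; apply: dual_eqP => t /=; rewrite mulVf ?pairing_neq0.
Qed.

HB.instance Definition _ :=
  GRing.isZmodule.Build (dual R G) dual_addA dual_addC dual_add0 dual_addN.

HB.instance Definition _ := Topological.copy (dual R G)
  (initial_topology
    (fun x : dual R G => (x : G -> R[i]^o) : {compact-open, G -> R[i]^o})).

End dual_group.

(** * Haar measure *)

(* G with its Borel sigma-algebra; the library's g_sigma_algebraType would ask
   for a pointedType. *)
Definition borel (G : topologicalZmodType) : Type := G.

HB.instance Definition _ (G : topologicalZmodType) := Choice.on (borel G).
HB.instance Definition _ (G : topologicalZmodType) :=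
  isPointed.Build (borel G) (0 : G).
HB.instance Definition _ (G : topologicalZmodType) :=
  @isMeasurable.Build (sigma_display (@open G)) (borel G)
    <<s (@open G) >> (@sigma_algebra0 _ setT (@open G))
    (@sigma_algebraC (borel G) (@open G))
    (@sigma_algebra_bigcup _ setT (@open G)).

Definition haar_measure (R : realType) (G : topologicalZmodType)
    (mu : {measure set (borel G) -> \bar R}) : Prop :=
  [/\ (0 < mu setT)%E,
      forall K : set G, compact K -> (mu K < +oo)%E,
      forall B : set (borel G), measurable B ->
        mu B = ereal_inf [set mu U | U in [set U : set G | open U /\ B `<=` U]],
      forall U : set G, open U ->
        mu U = ereal_sup [set mu K | K in [set K : set G | compact K /\ K `<=` U]]
    & forall (s : G) (B : set (borel G)), measurable B ->
        mu [set s + t | t in (B : set G)] = mu B].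

(** * The Bochner integral *)

Section bochner.
Variables (d : measure_display) (T : measurableType d) (R : realType).
Variables (V : completeNormedModType R[i]) (mu : {measure set T -> \bar R}).
Implicit Types (D : set T) (s f : T -> V).

(* No condition on the value 0, whose fibre has no weight in the integral. *)
Definition integrable_simple D s : Prop :=
  [/\ finite_set (range s),
      forall v, measurable (s @^-1` [set v])
    & forall v, v != 0 -> (mu (D `&` s @^-1` [set v]) < +oo)%E].

Definition simple_integral D s : V :=
  \sum_(v \in range s) (fine (mu (D `&` s @^-1` [set v])))%:C *: v.

Definition is_bochner_integral D f (I : V) : Prop :=
  exists s : nat -> T -> V,
    [/\ forall n, integrable_simple D (s n),
        {ae mu, forall t, D t -> s n t @[n --> \oo] --> f t},
        (\int[mu]_(t in D) (rnorm (f t - s n t))%:E)%E @[n --> \oo] --> 0%E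
      & simple_integral D (s n) @[n --> \oo] --> I].

Definition bochner_integrable D f : Prop := exists I, is_bochner_integral D f I.

Definition bochner_integral D f : V := xget 0 (is_bochner_integral D f).

End bochner.

Section unconditional.
Variables (R : realType) (G : topologicalZmodType).
Variables (V : completeNormedModType R[i]).
Variable mu : {measure set (borel G) -> \bar R}.

Definition relatively_compact (K : set G) : Prop :=
  measurable (K : set (borel G)) /\ precompact K.

(* The filter of tails of the relatively compact sets ordered by inclusion. *)
Definition relatively_compact_net : set_system (set G) :=
  filter_from relatively_compact
    (fun K0 => [set K | relatively_compact K /\ K0 `<=` K]).

Definition unconditionally_integrable (f : G -> V) : Prop :=
  (forall K, relatively_compact K ->
     bochner_integrable mu (K : set (borel G)) f) /\
  cvg (bochner_integral mu (K : set (borel G)) f @[K --> relatively_compact_net]).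

Definition unconditional_integral (f : G -> V) : V :=
  lim (bochner_integral mu (K : set (borel G)) f @[K --> relatively_compact_net]).

End unconditional.

(** * C*-dynamical systems *)

Definition star_automorphism (R : realType) (A : cstarAlgType R)
    (phi : A -> A) : Prop :=
  [/\ bijective phi, linear phi, {morph phi : a b / a ** b}
    & {morph phi : a / star a}].

Record cstar_action (R : realType) (A : cstarAlgType R)
    (G : topologicalZmodType) := CStarAction {
  action :> G -> A -> A ;
  action_star_automorphism : forall t, star_automorphism (action t) ;
  action0 : forall a, action 0 a = a ;
  actionD : forall s t a, action (s + t) a = action s (action t a) ;
  action_strongly_continuous : forall a, continuous (fun t => action t a)
}.

Section dynamical_system.
Variables (R : realType) (A : cstarAlgType R) (G : topologicalZmodType).
Variable alpha : cstar_action A G.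

Lemma action_mul t (a b : A) : alpha t (a ** b) = alpha t a ** alpha t b.
Proof. by case: (action_star_automorphism alpha t). Qed.

Lemma actionNK t : cancel (alpha (- t)) (alpha t).
Proof. by move=> a; rewrite -actionD addrN action0. Qed.

Fact maction_subproof t (m : multiplier A) (a b : A) :
  a ** alpha t (lmulm m (alpha (- t) b)) =
  alpha t (rmulm m (alpha (- t) a)) ** b.
Proof.
by rewrite -{1}(actionNK t a) -action_mul multiplierP action_mul actionNK.
Qed.

(* The extension of alpha to M(A), forced by
   alpha_t (m b) = alpha_t(m) alpha_t(b). *)
Definition maction (t : G) (m : multiplier A) : multiplier A :=
  Multiplier (maction_subproof t m).

Definition spectral_multipliers (x : dual R G) : set (multiplier A) :=
  [set m | forall t, maction t m = (x t)^* *: m].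

Variable mu : {measure set (borel G) -> \bar R}.

Definition alpha_integrable (a : A) : Prop :=
  forall b : A,
    unconditionally_integrable mu (fun t => alpha t a ** b) /\
    unconditionally_integrable mu (fun t => b ** alpha t a).

(* An alpha-integrable element has exactly one m as below for each x; the
   default 0 in fourier_coefficient only concerns other elements. *)
Definition is_fourier_coefficient (x : dual R G) (a : A) (m : multiplier A) :
    Prop :=
  forall b : A,
    lmulm m b = unconditional_integral mu (fun t => x t *: (alpha t a ** b)) /\
    rmulm m b = unconditional_integral mu (fun t => x t *: (b ** alpha t a)).

Definition fourier_coefficient (x : dual R G) (a : A) : multiplier A :=
  xget 0 (is_fourier_coefficient x a).

Definition relatively_continuous (a b : A) : Prop :=
  let E := fourier_coefficient in
  [/\ alpha_integrable a, alpha_integrable b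
    & forall eps : R, 0 < eps ->
        \forall z \near (0 : dual R G), forall x y : dual R G,
          (mnorm (mmul (E (x + z) a) (E y b) - mmul (E x a) (E (z + y) b))%R
             <= eps%:E)%E].

End dynamical_system.

(* Main.v *)
(* Everything is reduced to the behaviour of the Fourier coefficients:
   [E_x(a + b) = E_x(a) + E_x(b)], [E_x(a^* ) = E_{-x}(a)^*], and, for [m] in
   [M_w(A)], [E_x(m a) = m E_{x-w}(a)] and [E_x(a m) = E_{x-w}(a) m]; moreover
   [E_w(c)] lies in [M_w(A)] by translation invariance of the Haar measure, and
   [sup_x |E_x(a)|] is finite, which is what (iv) needs.  The bound in [x] comes
   from unconditionality: if the integrals of [f] over relatively compact sets
   are at most [M] in norm, so are those of [phi f] for [0 <= phi <= 1], because
   [phi] is a limit of averages of indicator functions; a character is a fixed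
   combination of [1] and two such functions.  The same estimate on the sets
   disjoint from a large relatively compact one shows that [f] times a character
   is again unconditionally integrable. *)

Require Import Defs.
From mathcomp Require Import all_boot all_order all_algebra.
From mathcomp Require Import all_classical all_reals all_analysis.
From mathcomp Require Import measurable_realfun ring lra zify.

Set Implicit Arguments.
Unset Strict Implicit.
Unset Printing Implicit Defensive.

Import Order.TTheory GRing.Theory Num.Theory.
Import numFieldNormedType.Exports.

Local Open Scope classical_set_scope.
Local Open Scope ring_scope.

(** * Real-valued norms *)

(** Two boundedness facts have to be earned. Moving [alpha t] through an integral, as is done to see
    that E_w(c) lies in M_w(A), requires [alpha t] to be bounded; its contractivity is derived from
    the C^*-identity alone, by estimating sums of even powers of a self-adjoint element, without
    spectra or functional calculus. A double centralizer is a bare pair of maps; its linearity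
    follows by cancellation in A, its boundedness from the uniform boundedness principle. The same
    principle gives the bound on E_x(a) uniform in x: unconditionality only bounds E_x(a) b for each
    fixed b. In (iv) the outer factors E_x(a) and E_y(b) of a triple product survive in the
    estimate, which is why this bound cannot be avoided there. Integrands are not assumed
    measurable, so errors of approximation are controlled by measurable majorants rather than by
    integrals of norms. *)

Section rnorm_theory.
Context {R : realType} {V : normedModType R[i]}.
Implicit Types u v w : V.
Local Open Scope complex_scope.

Lemma rnormE v : `|v| = (rnorm v)%:C.
Proof. by rewrite /rnorm RRe_real// ger0_real. Qed.

Lemma rnorm_ge0 v : 0 <= rnorm v.
Proof. by rewrite -ler0c -rnormE normr_ge0. Qed.

Lemma rnorm0 : rnorm (0 : V) = 0.
Proof. by rewrite /rnorm normr0. Qed.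

Lemma rnorm_eq0 v : (rnorm v == 0) = (v == 0).
Proof. by rewrite -(normr_eq0 v) rnormE -(inj_eq (@complexI R)). Qed.

Lemma rnormN v : rnorm (- v) = rnorm v.
Proof. by rewrite /rnorm normrN. Qed.

Lemma rnormB v w : rnorm (v - w) = rnorm (w - v).
Proof. by rewrite -rnormN opprB. Qed.

Lemma rnormD v w : rnorm (v + w) <= rnorm v + rnorm w.
Proof. by rewrite -lecR rmorphD/= -!rnormE ler_normD. Qed.

Lemma rnorm_triangle u v w : rnorm (u - w) <= rnorm (u - v) + rnorm (v - w).
Proof. by rewrite (le_trans _ (rnormD _ _))// addrA subrK. Qed.

Lemma rnormZ (k : R[i]) v : rnorm (k *: v) = complex.Re `|k| * rnorm v.
Proof.
apply: (@complexI R); rewrite rmorphM/= -!rnormE normrZ.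
by rewrite (RRe_real (ger0_real (normr_ge0 k))).
Qed.

Lemma rnormZr (r : R) v : rnorm (r%:C *: v) = `|r| * rnorm v.
Proof.
rewrite rnormZ; congr (_ * _).
by rewrite normc_def /= expr0n addr0 sqrtr_sqr.
Qed.

Lemma rnorm_double v : rnorm (v + v) = 2 * rnorm v.
Proof.
by rewrite -mulr2n -scaler_nat -(rmorph_nat (real_complex R)) rnormZr normr_nat.
Qed.

Lemma rnorm_sum (I : Type) (s : seq I) (P : pred I) (F : I -> V) :
  rnorm (\sum_(i <- s | P i) F i) <= \sum_(i <- s | P i) rnorm (F i).
Proof.
elim/big_ind2 : _ => [|x1 x2 y1 y2 h1 h2|//]; first by rewrite rnorm0.
by rewrite (le_trans (rnormD _ _))// lerD.
Qed.

(** Comparable elements of [R[i]] have equal imaginary parts, so a positive one is real. This turns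
    the complex tolerances of normed-module convergence into real ones. *)
Lemma gt0_complexP (e : R[i]) : 0 < e -> exists2 r : R, 0 < r & e = r%:C.
Proof.
move=> e0; exists (complex.Re e); first by move: e0; rewrite ltcE => /andP[].
by rewrite RRe_real// gtr0_real.
Qed.

Lemma cvg_rnormP {F : set_system V} {FF : Filter F} (l : V) :
  (F --> l) <-> (forall e : R, 0 < e -> \forall v \near F, rnorm (v - l) < e).
Proof.
split=> [/cvgrPdist_lt h e e0|h].
  have /h : 0 < e%:C by rewrite ltcR.
  by apply: filterS => v; rewrite distrC rnormE ltcR.
apply/cvgrPdist_lt => _ /gt0_complexP[e e0 ->].
by apply: filterS (h _ e0) => v; rewrite distrC rnormE ltcR.
Qed.

Lemma cvg_rnorm_fmapP {T} {F : set_system T} {FF : Filter F} (f : T -> V) (l : V) :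
  (f x @[x --> F] --> l) <->
  (forall e : R, 0 < e -> \forall x \near F, rnorm (f x - l) < e).
Proof. exact: cvg_rnormP. Qed.

End rnorm_theory.

Section rnorm_complete.
Context {R : realType} {V : completeNormedModType R[i]}.
Local Open Scope complex_scope.

(** Stated for filters because unconditional integrals are limits along the net of relatively
    compact sets. *)
Lemma cauchy_rnorm_cvg {F : set_system V} {FF : ProperFilter F} :
  (forall e : R, 0 < e -> exists w : V, \forall v \near F, rnorm (v - w) < e) ->
  exists l : V, F --> l.
Proof.
move=> h; suff /cauchy_cvgP cF : cauchy F by apply/cvg_ex.
apply: cauchy_exP => _ /gt0_complexP[e e0 ->].
have [w hw] := h _ e0; exists w.
by apply: filterS hw => v; rewrite -ball_normE /ball_/= distrC rnormE ltcR.
Qed.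

Lemma cauchy_seq_rnorm (u : nat -> V) :
  (forall e : R, 0 < e ->
    exists N, forall n, (N <= n)%N -> rnorm (u n - u N) < e) ->
  exists l : V, u n @[n --> \oo] --> l.
Proof.
move=> h; apply: cauchy_rnorm_cvg => e /h[N hN]; exists (u N).
by exists N => // n /= /hN.
Qed.

End rnorm_complete.

Lemma rnorm_eq0_lt {R : realType} {V : normedModType R[i]} (v : V) :
  (forall e : R, 0 < e -> rnorm v < e) -> v = 0.
Proof.
move=> h; apply/eqP; rewrite -rnorm_eq0; apply/eqP/le_anti.
rewrite rnorm_ge0 andbT; apply/ler_addgt0Pr => e e0; rewrite add0r.
exact/ltW/h.
Qed.

(** * Norm and involution in a C*-algebra *)

Section cstar_norm.
Context {R : realType} {A : cstarAlgType R}.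
Implicit Types a b : A.
Local Open Scope complex_scope.

Lemma rnorm_cmul a b : rnorm (a ** b) <= rnorm a * rnorm b.
Proof. by rewrite -lecR rmorphM/= -!rnormE norm_cmul_le. Qed.

Lemma rnorm_cstar a : rnorm (star a ** a) = rnorm a ^+ 2.
Proof. by apply: (@complexI R); rewrite rmorphXn/= -!rnormE cstar_identity. Qed.

Lemma star0 : star (0 : A) = 0.
Proof. by apply: (addrI (star 0)); rewrite -starD !addr0. Qed.

Lemma starN a : star (- a) = - star a.
Proof. by apply: (addrI (star a)); rewrite -starD !subrr star0. Qed.

Lemma starB a b : star (a - b) = star a - star b.
Proof. by rewrite starD starN. Qed.

(** From |b|^2 = |b^* b| <= |b^*| |b| one cancels |b|; applying this to b and to b^* gives both
    inequalities. *)
Lemma rnorm_star a : rnorm (star a) = rnorm a.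
Proof.
suff h b : rnorm b <= rnorm (star b).
  by apply: le_anti; rewrite h -{2}(starK a) h.
have [->|b0] := eqVneq b 0; first by rewrite star0.
have b_gt0 : 0 < rnorm b by rewrite lt_neqAle eq_sym rnorm_eq0 b0 rnorm_ge0.
by rewrite -(ler_pM2r b_gt0) -expr2 -rnorm_cstar rnorm_cmul.
Qed.

Lemma rnorm_cstar_r a : rnorm (a ** star a) = rnorm a ^+ 2.
Proof. by rewrite -{1}(starK a) rnorm_cstar rnorm_star. Qed.

Lemma cmulBl a b c : (a - b) ** c = a ** c - b ** c :> A.
Proof. by rewrite cmulDl cmulNl. Qed.

Lemma cmulBr a b c : c ** (a - b) = c ** a - c ** b :> A.
Proof. by rewrite cmulDr cmulNr. Qed.

(** Test with b = a^*. This and its mirror image replace multiplication by a unit. *)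
Lemma cmul_left_eq0 a : (forall b, a ** b = 0) -> a = 0.
Proof.
move=> h; apply/eqP; rewrite -rnorm_eq0 -sqrf_eq0 -rnorm_cstar_r h.
by rewrite rnorm0.
Qed.

Lemma cmul_right_eq0 a : (forall b, b ** a = 0) -> a = 0.
Proof.
move=> h; apply/eqP; rewrite -rnorm_eq0 -sqrf_eq0 -rnorm_cstar h.
by rewrite rnorm0.
Qed.

End cstar_norm.

(** * Continuity of star-automorphisms *)

Section geometric_cauchy.
Context {R : realType} {V : completeNormedModType R[i]}.

Lemma geometric_cvg (u : nat -> V) (C q : R) : 0 <= q < 1 ->
  (forall n, rnorm (u n.+1 - u n) <= C * q ^+ n) ->
  exists l : V, u n @[n --> \oo] --> l.
Proof.
move=> /andP[q0 q1] hu.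
have C0 : 0 <= C by have := hu 0%N; rewrite expr0 mulr1; apply/le_trans/rnorm_ge0.
have q'0 : 0 < 1 - q by rewrite subr_gt0.
(* The exact value of the partial geometric sum, so that the two bounds of the induction step add up
   with equality. *)
have hk n k : rnorm (u (n + k)%N - u n) <= C * q ^+ n * (1 - q ^+ k) / (1 - q).
  elim: k => [|k ih]; first by rewrite addn0 subrr rnorm0 expr0 subrr mulr0 mul0r.
  rewrite addnS (le_trans (rnorm_triangle _ (u (n + k)%N) _))//.
  rewrite (le_trans (lerD (hu _) ih))// -subr_ge0 exprD exprS.
  by rewrite le_eqVlt; apply/orP; left; apply/eqP; field; rewrite gt_eqF.
apply: cauchy_seq_rnorm => e e0.
have : C * q ^+ n / (1 - q) @[n --> \oo] --> C * 0 / (1 - q).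
  by apply: cvgMl; apply: cvgMr; apply: cvg_expr; rewrite ger0_norm.
rewrite mulr0 mul0r => /cvgrPdist_lt/(_ _ e0)[N _ hN]; exists N => n Nn.
rewrite -(subnKC Nn) (le_lt_trans (hk _ _))//.
have := hN N (leqnn N); rewrite /= sub0r normrN ger0_norm => [|]; last first.
  by rewrite divr_ge0 ?mulr_ge0 ?exprn_ge0// ltW.
apply: le_lt_trans; rewrite ler_pM2r ?invr_gt0// ler_piMr ?mulr_ge0 ?exprn_ge0//.
by rewrite gerBl exprn_ge0.
Qed.

End geometric_cauchy.

(** * Lower bounds for sums of even powers *)

Section positive_powers.
Context {R : realType} {A : cstarAlgType R}.
Implicit Types a b c g h k u v : A.
Local Open Scope complex_scope.

Lemma cmul_suml (I : Type) (r : seq I) (F : I -> A) a :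
  (\sum_(i <- r) F i) ** a = \sum_(i <- r) (F i ** a).
Proof.
by apply: (big_morph (cmul^~ a)) => [x y|]; rewrite ?cmulDl ?cmul0l.
Qed.

Lemma cmul_sumr (I : Type) (r : seq I) (F : I -> A) a :
  a ** (\sum_(i <- r) F i) = \sum_(i <- r) (a ** F i).
Proof.
by apply: (big_morph (cmul a)) => [x y|]; rewrite ?cmulDr ?cmul0r.
Qed.

Lemma star_sum (I : Type) (r : seq I) (F : I -> A) :
  star (\sum_(i <- r) F i) = \sum_(i <- r) star (F i).
Proof. by apply: (big_morph star) => [x y|]; rewrite ?starD ?star0. Qed.

(* For commuting self-adjoint [u], [v] the normal element [z = u + i v] satisfies
   [z^* z = u^2 + v^2] and [u = (z + z^* ) / 2]. *)
Lemma rnorm_le_sum_sqr u v : star u = u -> star v = v -> u ** v = v ** u ->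
  rnorm u ^+ 2 <= rnorm (u ** u + v ** v) :> R.
Proof.
move=> su sv uv.
set z := u + 'i *: v.
have sz : star z = u - 'i *: v.
  rewrite starD starZ su sv -scaleNr; congr (_ + _ *: _).
  by apply/eqP; rewrite eq_complex /= oppr0 !eqxx.
have zz : star z ** z = u ** u + v ** v.
  rewrite sz /z cmulBl !cmulDr !cmulZl !cmulZr scalerA -expr2 sqr_i scaleN1r.
  by rewrite uv opprD opprK addrA addrK.
rewrite -zz rnorm_cstar ler_sqr ?nnegrE ?rnorm_ge0//.
rewrite -(ler_pM2l (@ltr0n R 2)) -rnorm_double mulr2n mulrDl mul1r.
have -> : u + u = z + star z by rewrite sz /z addrACA subrr addr0.
by rewrite (le_trans (rnormD _ _))// rnorm_star.
Qed.

(** An arithmetic-geometric mean inequality: (a + b)^2 = (2c)^2 + (a - b)^2 when ab = ba = c^2, so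
    [rnorm_le_sum_sqr] applies to u = 2c and v = a - b. *)
Lemma rnorm_add_ge a b c : star a = a -> star b = b -> star c = c ->
  a ** b = c ** c -> b ** a = c ** c -> a ** c = c ** a -> b ** c = c ** b ->
  2 * rnorm c <= rnorm (a + b) :> R.
Proof.
move=> sa sb sc ab ba ac bc.
have := @rnorm_le_sum_sqr (c + c) (a - b).
rewrite starD sc starB sa sb => /(_ erefl erefl).
have -> : (c + c) ** (c + c) + (a - b) ** (a - b) = (a + b) ** (a + b).
  rewrite !(cmulDl, cmulBl, cmulDr, cmulBr) ab ba.
  rewrite opprB [X in _ + X]addrACA -opprD.
  set X := c ** c + c ** c; rewrite (addrC (a ** a + _)) addrACA subrr add0r.
  by rewrite /X (addrC (c ** c) (b ** b)) addrC [RHS]addrACA.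
rewrite rnorm_double.
have sab : star (a + b) = a + b by rewrite starD sa sb.
rewrite -{1}sab rnorm_cstar ler_sqr ?nnegrE ?rnorm_ge0 ?mulr_ge0 ?rnorm_ge0//.
by apply; rewrite !(cmulDl, cmulBl, cmulDr, cmulBr) ac bc.
Qed.

(* The n.+1-st power. *)
Definition cpow g n := iter n (cmul g) g.

Lemma cpowD g m n : cpow g m ** cpow g n = cpow g (m + n).+1.
Proof. by elim: m => //= m ih; rewrite -cmulA ih. Qed.

Lemma star_cpow g n : star g = g -> star (cpow g n) = cpow g n.
Proof.
move=> sg; elim: n => //= n ih; rewrite starM ih sg.
by rewrite -[X in _ ** X]/(cpow g 0) cpowD addn0.
Qed.

(** Since [cpow g n] is g^(n+1), this is g^(m+2) + g^(m+4) + ... + g^(m+2N). The shift m allows both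
    halves of a longer sum to have the same form. *)
Definition cpow_sum g m N := \sum_(0 <= j < N) cpow g (j.*2.+1 + m).

(** Morally the sum with shift m is g^m times the sum with shift 0, so only the total shift matters.
    This supplies every product hypothesis of [rnorm_add_ge]. *)
Lemma cpow_sumM g N m1 m2 m3 m4 : (m1 + m2 = m3 + m4)%N ->
  cpow_sum g m1 N ** cpow_sum g m2 N = cpow_sum g m3 N ** cpow_sum g m4 N.
Proof.
move=> e; rewrite /cpow_sum !cmul_suml; apply: eq_bigr => i _.
rewrite !cmul_sumr; apply: eq_bigr => j _; rewrite !cpowD.
by congr (cpow g _.+1); rewrite !(addnACA _ _ j.*2.+1) e.
Qed.

Lemma star_cpow_sum g m N : star g = g -> star (cpow_sum g m N) = cpow_sum g m N.
Proof. by move=> sg; rewrite star_sum; apply: eq_bigr => i _; exact: star_cpow. Qed.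

Lemma cpow_sum_cat g m N :
  cpow_sum g m (N + N) = cpow_sum g m N + cpow_sum g (m + N.*2) N.
Proof.
rewrite /cpow_sum (big_cat_nat (leq0n N) (leq_addr N N))/=; congr (_ + _).
rewrite -{1}(add0n N) big_addn addnK; apply: eq_bigr => j _.
by congr (_ ** cpow g _); rewrite doubleD -addnA (addnC m).
Qed.

Lemma rnorm_cpow_le1 g n : rnorm g = 1 -> rnorm (cpow g n) <= 1 :> R.
Proof.
move=> g1; elim: n => [|n ih]/=; first by rewrite g1.
by rewrite (le_trans (rnorm_cmul _ _))// g1 mul1r.
Qed.

(** The C^*-identity gives norm 1 to the powers with exponent 2^k. Norms of powers do not increase,
    so every power below such an exponent has norm at least 1. *)
Lemma rnorm_cpow g n : star g = g -> rnorm g = 1 -> rnorm (cpow g n) = 1 :> R.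
Proof.
move=> sg g1; apply/eqP; rewrite eq_le rnorm_cpow_le1//=.
have hn (l : nat) : rnorm (cpow g (2 ^ l).-1) = 1 :> R.
  elim: l => //= k ih.
  have -> : (2 ^ k.+1).-1 = ((2 ^ k).-1 + (2 ^ k).-1).+1.
    by rewrite expnS mul2n -addnn; case: (2 ^ k)%N (expn_gt0 2 k) => //= m _; rewrite addnS.
  by rewrite -cpowD -{1}(star_cpow _ sg) rnorm_cstar ih expr1n.
rewrite -(hn n).
have : (n <= (2 ^ n).-1)%N by rewrite -ltnS prednK ?expn_gt0// ltn_expl.
move=> /subnKC <-; move: (_ - n)%N => k.
elim: k => [|k ih]; first by rewrite addn0.
rewrite addnS; apply: le_trans ih => /=.
by rewrite (le_trans (rnorm_cmul _ _))// g1 mul1r.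
Qed.

(** Doubling: with N = 2^n, the two halves of the sum of 2N terms have shifts m and m + 2N, and the
    sum with the middle shift m + N is their geometric mean. By [rnorm_add_ge] the lower bound
    doubles with the number of terms. *)
Lemma rnorm_cpow_sum_ge g m n : star g = g -> rnorm g = 1 ->
  2 ^+ n <= rnorm (cpow_sum g m (2 ^ n)) :> R.
Proof.
move=> sg g1; elim: n m => [|n ih] m.
  by rewrite expn0 /cpow_sum big_nat1 expr0 rnorm_cpow.
rewrite expnS mul2n -addnn cpow_sum_cat exprS.
set N := (2 ^ n)%N.
apply: (@le_trans _ _ (2 * rnorm (cpow_sum g (m + N) N))); first by rewrite ler_pM2l.
apply: rnorm_add_ge; rewrite ?star_cpow_sum//; apply: cpow_sumM;
  rewrite -?addnn; lia.
Qed.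

(** S stands for k (1 - k)^-1 = k + k^2 + ..., which makes sense without a unit; it is the fixed
    point of a contraction. *)
Lemma neumann_series k : rnorm k < 1 :> R -> exists S, S = k + k ** S.
Proof.
move=> k1.
pose u n := iter n (fun x => k + k ** x) k.
have hu n : rnorm (u n.+1 - u n) <= 1 * rnorm k ^+ n :> R.
  rewrite mul1r; elim: n => [|n ih].
    rewrite /= addrC addKr expr0 (le_trans (rnorm_cmul _ _))//.
    by rewrite mulr_ile1// ?rnorm_ge0// ltW.
  rewrite exprS /= opprD addrACA subrr add0r -cmulBr.
  by rewrite (le_trans (rnorm_cmul _ _))// ler_wpM2l ?rnorm_ge0.
have [|S] := geometric_cvg _ hu; first by rewrite rnorm_ge0.
move=> /cvg_rnorm_fmapP hS; exists S; apply/eqP; rewrite -subr_eq0; apply/eqP.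
apply: rnorm_eq0_lt => e e0.
have [N _ hN] := hS _ (divr_gt0 e0 (ltr0n R 2)).
have h1 := hN _ (leqnSn N); have h2 := hN _ (leqnn N).
rewrite (le_lt_trans (rnorm_triangle _ (u N.+1) _))// (splitr e) ltrD//.
  by rewrite rnormB.
rewrite /= opprD addrACA subrr add0r -cmulBr.
rewrite (le_lt_trans (rnorm_cmul _ _))// (le_lt_trans _ h2)//.
by rewrite ler_piMl ?rnorm_ge0// ltW.
Qed.

End positive_powers.

(** * Star-automorphisms are contractive *)

Section star_automorphism_contraction.
Context {R : realType} {A : cstarAlgType R}.
Variables (phi : A -> A) (phiP : star_automorphism phi).
Local Open Scope complex_scope.

Let phi_linear : linear phi. Proof. by case: phiP. Qed.

Let phiD : {morph phi : a b / a + b}.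
Proof. by move=> a b; have := phi_linear 1 a b; rewrite !scale1r. Qed.

Let phi0 : phi 0 = 0.
Proof. by apply: (addrI (phi 0)); rewrite -phiD !addr0. Qed.

Let phiZ (k : R[i]) : {morph phi : a / k *: a}.
Proof. by move=> a; have := phi_linear k a 0; rewrite phi0 !addr0. Qed.

Let phiM : {morph phi : a b / a ** b}. Proof. by case: phiP. Qed.

Let phiS : {morph phi : a / star a}. Proof. by case: phiP. Qed.

(* If [|h| < 1 = |g|] with [g = phi h], then [s = phi (h^2 (1 - h^2)^-1)] bounds
   all the sums [g^2 + ... + g^(2N)], against [rnorm_cpow_sum_ge]. *)
Lemma star_automorphism_norm1 (h : A) : star h = h -> rnorm (phi h) = 1 ->
  1 <= rnorm h :> R.
Proof.
move=> sh g1; rewrite leNgt; apply/negP => h1.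
have [|S hS] := @neumann_series R A (h ** h).
  by rewrite -{1}sh rnorm_cstar exprn_ilt1// rnorm_ge0.
set g := phi h in g1.
have sg : star g = g by rewrite /g -phiS sh.
have hs : phi S = cpow g 1 + cpow g 1 ** phi S by rewrite {1}hS phiD !phiM.
have hQ N : phi S = cpow_sum g 0 N.+1 + cpow g N.*2.+1 ** phi S.
  elim: N => [|N ih]; first by rewrite /cpow_sum big_nat1 addn0.
  rewrite {1}ih {1}hs cmulDr cmulA cpowD addn1 addrA.
  by rewrite /cpow_sum [in RHS]big_nat_recr//= addn0.
have hb N : rnorm (cpow_sum g 0 N.+1) <= 2 * rnorm (phi S) :> R.
  have -> : cpow_sum g 0 N.+1 = phi S - cpow g N.*2.+1 ** phi S.
    by rewrite {1}(hQ N) addrK.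
  rewrite (le_trans (rnormD _ _))// rnormN mulr2n mulrDl mul1r lerD2l.
  rewrite (le_trans (rnorm_cmul _ _))// ler_piMl ?rnorm_ge0//.
  exact: rnorm_cpow_le1.
have {}hb n : n%:R <= 2 * rnorm (phi S) :> R.
  apply: le_trans (hb (2 ^ n).-1); rewrite prednK ?expn_gt0//.
  by rewrite (le_trans _ (rnorm_cpow_sum_ge _ _ sg g1))// -natrX ler_nat ltnW// ltn_expl.
have := archi_boundP (mulr_ge0 (ler0n R 2) (rnorm_ge0 (phi S))).
by rewrite ltNge hb.
Qed.

(** Since |phi a|^2 = |phi (a^* a)|, self-adjoint elements suffice; these are rescaled so that the
    image has norm 1. *)
Lemma star_automorphism_norm (a : A) : rnorm (phi a) <= rnorm a :> R.
Proof.
suff sa (h : A) : star h = h -> rnorm (phi h) <= rnorm h :> R.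
  rewrite -ler_sqr ?nnegrE ?rnorm_ge0// -!rnorm_cstar -phiS -phiM sa//.
  by rewrite starM starK.
move=> sh; have [->|n0] := eqVneq (phi h) 0; first by rewrite rnorm0 rnorm_ge0.
have r0 : 0 < rnorm (phi h) by rewrite lt_neqAle eq_sym rnorm_eq0 n0 rnorm_ge0.
have := @star_automorphism_norm1 ((rnorm (phi h))^-1%:C *: h).
rewrite starZ sh phiZ !rnormZr normfV (gtr0_norm r0) mulVf ?gt_eqF//.
rewrite mulrC ler_pdivlMr// mul1r; apply => //.
by congr (_ *: _); apply/eqP; rewrite eq_complex /= oppr0 !eqxx.
Qed.

End star_automorphism_contraction.

(** * Uniform boundedness *)

Section bounded_real_linear.
Context {R : realType}.
Local Open Scope complex_scope.

(* Real linearity, so that the involution is covered. *)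
Definition bounded_real_linear (V W : normedModType R[i]) (T : V -> W) :=
  [/\ {morph T : u v / u + v},
      forall (r : R) v, T (r%:C *: v) = r%:C *: T v
    & exists2 C : R, 0 <= C & forall v, rnorm (T v) <= C * rnorm v].

Lemma brl0 (V W : normedModType R[i]) (T : V -> W) :
  bounded_real_linear T -> T 0 = 0.
Proof. by case=> + _ _ => h; apply: (addrI (T 0)); rewrite -h !addr0. Qed.

Lemma brlN (V W : normedModType R[i]) (T : V -> W) v :
  bounded_real_linear T -> T (- v) = - T v.
Proof.
by move=> h; apply: (addrI (T v)); case: (h) => <- _ _; rewrite !subrr brl0.
Qed.

Lemma brlB (V W : normedModType R[i]) (T : V -> W) u v :
  bounded_real_linear T -> T (u - v) = T u - T v.
Proof. by move=> h; rewrite -brlN//; case: h => ->. Qed.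

(** If no uniform bound exists, one constructs shrinking nested balls such that some [T i] is at
    least n on the n-th one. The limit of the centres lies in all of them and contradicts pointwise
    boundedness. *)
Theorem uniform_boundedness (V : completeNormedModType R[i])
    (W : normedModType R[i]) (I : Type) (T : I -> V -> W) :
  (forall i, bounded_real_linear (T i)) ->
  (forall v, exists M : R, forall i, rnorm (T i v) <= M) ->
  exists2 C : R, 0 <= C & forall i v, rnorm (T i v) <= C * rnorm v.
Proof.
move=> brlT pwb; apply: contrapT => unb.
have large (C r : R) : 0 <= C -> 0 < r ->
    exists i v, rnorm v = r /\ C <= rnorm (T i v).
  move=> C0 r0; apply: contrapT => h; apply: unb.
  exists (C / r) => [|i v]; first by rewrite divr_ge0// ltW.
  have [->|v0] := eqVneq v 0; first by rewrite (brl0 (brlT i)) !rnorm0 mulr0.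
  have v0' : 0 < rnorm v by rewrite lt_neqAle eq_sym rnorm_eq0 v0 rnorm_ge0.
  rewrite leNgt; apply/negP => hv; apply: h.
  exists i, ((r / rnorm v)%:C *: v).
  have q0 : 0 < r / rnorm v by rewrite divr_gt0.
  case: (brlT i) => _ -> _; rewrite !rnormZr gtr0_norm//; split.
    by rewrite divfK// gt_eqF.
  rewrite mulrAC ler_pdivlMr// mulrC -ler_pdivrMl// mulrC.
  by rewrite mulrA (mulrC _ C) ltW.
have step (n : nat) (x : V) (r : R) : 0 < r -> exists x' r', [/\ 0 < r',
    r' <= r / 2, rnorm (x' - x) <= r / 2 &
    exists i, forall y, rnorm (y - x') <= r' -> n%:R <= rnorm (T i y)].
  move=> r0; have r20 : 0 < r / 2 by rewrite divr_gt0.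
  (* As 2 T(v) = T(x + v) - T(x - v), one of the points x + v and x - v has an image at least as
     large as that of v, wherever x is. *)
  have [i [v [vr hv]]] := large (n%:R + 1) _ (addr_ge0 (ler0n _ n) ler01) r20.
  have [x' x'x hx'] : exists2 x', rnorm (x' - x) <= r / 2 &
      n%:R + 1 <= rnorm (T i x').
    have [h|h] := leP (n%:R + 1) (rnorm (T i (x + v))).
      by exists (x + v) => //; rewrite addrC addKr vr.
    exists (x - v) => //; first by rewrite addrC addKr rnormN vr.
    have e : T i v + T i v = T i (x + v) - T i (x - v).
      rewrite -(brlB _ _ (brlT i)).
      have -> : x + v - (x - v) = v + v by rewrite opprB addrC addrA subrK.
      by case: (brlT i) => ->.
    have h2 : 2 * rnorm (T i v) <= rnorm (T i (x + v)) + rnorm (T i (x - v)).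
      rewrite -(rnormN (T i (x - v))); apply: le_trans (rnormD _ _).
      by rewrite -e rnorm_double.
    lra.
  have [_ _ [C C0 hC]] := brlT i.
  (* On a ball of radius 1/(C + 1) the values of [T i] vary by at most 1, which uses up the extra 1
     in the choice of v. *)
  exists x', (Num.min (r / 2) (C + 1)^-1).
  have C10 : 0 < C + 1 by lra.
  split; rewrite ?lt_min ?r20 ?invr_gt0 ?C10 ?ge_min ?lexx//.
  exists i => y; rewrite le_min => /andP[_ hy].
  have h3 : rnorm (T i x') <= rnorm (T i y) + 1.
    rewrite -lerBlDl.
    have h4 : rnorm (T i x') <= rnorm (T i y) + rnorm (T i (x' - y)).
      have {1}-> : x' = y + (x' - y) by rewrite addrC subrK.
      by case: (brlT i) => -> _ _; exact: rnormD.
    rewrite lerBlDl (le_trans h4)// lerD2l (le_trans (hC _))// rnormB.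
    rewrite (@le_trans _ _ ((C + 1) * rnorm (y - x')))//.
      by rewrite ler_wpM2r ?rnorm_ge0// lerDl.
    by rewrite -ler_pdivlMl// mulr1.
  lra.
have /choice[F hF] (nxr : nat * (V * R)) : exists x'r' : V * R,
    0 < nxr.2.2 -> [/\ 0 < x'r'.2, x'r'.2 <= nxr.2.2 / 2,
      rnorm (x'r'.1 - nxr.2.1) <= nxr.2.2 / 2 &
      exists i, forall y, rnorm (y - x'r'.1) <= x'r'.2 ->
        nxr.1%:R <= rnorm (T i y)].
  case: nxr => n [x r] /=; have [r0|r0] := ltP 0 r; last by exists (x, r).
  by have [x' [r' h]] := step n x r r0; exists (x', r').
pose s := fix s n := if n is m.+1 then F (m, s m) else (0 : V, 1 : R).
have s0 n : 0 < (s n).2 by elim: n => [|n ih]//=; case: (hF (n, s n) ih).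
have sh n : (s n).2 <= 2^-1 ^+ n.
  elim: n => [|n ih]//=; case: (hF (n, s n) (s0 n)) => _ h _ _.
  by rewrite (le_trans h)//= exprSr ler_pM2r.
(* A step moves the centre by at most r/2 and the new radius r' is at most r/2, so the move is at
   most r - r'; these differences telescope. *)
have snear n k : rnorm ((s (n + k)%N).1 - (s n).1) <= (s n).2 - (s (n + k)%N).2.
  elim: k => [|k ih]; first by rewrite addn0 !subrr rnorm0.
  rewrite addnS (le_trans (rnorm_triangle _ (s (n + k)%N).1 _))//.
  have [_ /=] := hF ((n + k)%N, s (n + k)%N) (s0 _).
  by move: ih; set a := rnorm _; set b := rnorm _ => *; lra.
have [||l /cvg_rnorm_fmapP hl] := @geometric_cvg R V (fun n => (s n).1) 1 2^-1.
- by lra.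
- move=> n; rewrite mul1r; have := snear n 1%N; rewrite addn1 => h.
  by have := s0 n.+1; have := sh n; lra.
have lnear n : rnorm (l - (s n).1) <= (s n).2.
  apply/ler_addgt0Pr => e e0; have [N _ hN] := hl _ e0.
  have := hN (n + N)%N (leq_addl _ _); rewrite /= rnormB => h1.
  have := snear n N; have := s0 (n + N)%N.
  by have := rnorm_triangle l (s (n + N)%N).1 (s n).1; lra.
have [M hM] := pwb l.
have M0 : 0 <= M.
  by have [i [v _]] := large 0 1 (lexx 0) ltr01; exact: le_trans (rnorm_ge0 _) (hM i).
(* The ball with index n + 1 was built from the requirement with index n, and n exceeds M. *)
have := archi_boundP M0; set n := Num.bound M.
have [_ _ _ [i /(_ l (lnear n.+1)) /= hi]] := hF (n, s n) (s0 n).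
by have := hM i; lra.
Qed.

End bounded_real_linear.

(** * Simple functions *)

Section simple_functions.
Context {d} {T : measurableType d}.

(** The target is any type, so that pairs of simple functions and Boolean indicators are simple too.
    On a domain of finite measure this agrees with [integrable_simple], see [integrable_simpleP]. *)
Definition is_simple (W : Type) (s : T -> W) :=
  finite_set (range s) /\ forall w, measurable (s @^-1` [set w]).

(** A set of values meets the range in finitely many points, so its preimage is a finite union of
    fibres. Hence a simple function may be followed by any function whatever. *)
Lemma is_simple_preimage (W : Type) (s : T -> W) (Y : set W) :
  is_simple s -> measurable (s @^-1` Y).
Proof.
move=> [fs ms].
rewrite (_ : s @^-1` Y = \bigcup_(w in range s `&` Y) s @^-1` [set w]).
  by apply: fin_bigcup_measurable => //; exact: finite_setIl.
by apply/seteqP; split=> [t Yt|t [w [_ Yw] /= ->]//]; exists (s t).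
Qed.

Lemma is_simple_comp (W W' : Type) (s : T -> W) (u : W -> W') :
  is_simple s -> is_simple (fun t => u (s t)).
Proof.
move=> ss; split=> [|w]; last exact: (is_simple_preimage (u @^-1` [set w]) ss).
apply: (sub_finite_set _ (finite_image u (proj1 ss))) => _ [t _ <-].
by exists (s t).
Qed.

Lemma is_simple_pair (W W' : Type) (s : T -> W) (s' : T -> W') :
  is_simple s -> is_simple s' -> is_simple (fun t => (s t, s' t)).
Proof.
move=> [fs ms] [fs' ms']; split=> [|[w w']].
  apply: (sub_finite_set _ (finite_setX fs fs')) => _ [t _ <-].
  by split; exists t.
rewrite (_ : _ @^-1` _ = s @^-1` [set w] `&` s' @^-1` [set w']).
  exact: measurableI.
by apply/seteqP; split=> [t /= [<- <-]//|t [/= <- <-]].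
Qed.

Lemma is_simple_mem (F : set T) : measurable F -> is_simple (fun t => t \in F).
Proof.
move=> mF; split=> [|[]].
- exact: (sub_finite_set (@subsetT _ _)).
- rewrite (_ : _ @^-1` _ = F)//.
  by apply/seteqP; split=> t /= => [/set_mem|/mem_set].
- rewrite (_ : _ @^-1` _ = ~` F); first exact: measurableC.
  by apply/seteqP; split=> t /=; [move/negbT; rewrite notin_setE|move=> nFt; apply/negbTE; rewrite notin_setE].
Qed.

Lemma is_simple_measurable_fun d' (T' : measurableType d') (W : Type)
  (s : T -> W) (h : W -> T') (E : set T) :
  is_simple s -> measurable_fun E (fun t => h (s t)).
Proof.
by move=> ss mE Y mY; apply: measurableI => //; exact: (is_simple_preimage (h @^-1` Y) ss).
Qed.

End simple_functions.

Section nonmeasurable_integral.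
Local Open Scope ereal_scope.

(* The integral of a nonnegative function is a supremum over the simple
   functions below it, so monotonicity needs no measurability. *)
Lemma ge0_le_lower_integral d (T : measurableType d) (R : realType)
    (mu : {measure set T -> \bar R}) (D : set T) (f g : T -> \bar R) :
  (forall t, D t -> 0 <= f t) -> (forall t, D t -> f t <= g t) ->
  \int[mu]_(t in D) f t <= \int[mu]_(t in D) g t.
Proof.
move=> f0 fg; have g0 t : D t -> 0 <= g t by move=> Dt; exact: le_trans (f0 t Dt) (fg t Dt).
rewrite !ge0_integralE//; apply: ereal_sup_le => _ [h /= hf <-].
exists h => //= t; apply: le_trans (hf t) _.
by rewrite !patchE; case: ifPn => // /set_mem; exact: fg.
Qed.

End nonmeasurable_integral.

(** * Integrals of simple functions *)

Section simple_integral_theory.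
Context {d} {T : measurableType d} {R : realType}.
Context {V : completeNormedModType R[i]} (mu : {measure set T -> \bar R}).
Variable D : set T.
Hypotheses (mD : measurable D) (muD : (mu D < +oo)%E).
Local Open Scope complex_scope.

Let m (F : set T) : R := fine (mu (D `&` F)).

Lemma fin_num_measureI (F : set T) : measurable F -> mu (D `&` F) = (m F)%:E.
Proof.
move=> mF; rewrite fineK// ge0_fin_numE// (le_lt_trans _ muD)//.
by apply: le_measure; rewrite ?inE//; exact: measurableI.
Qed.

(** Passage to a finer partition: the fibre of u o p over v is the disjoint union of the fibres of p
    over the preimages of v. With p a pair of simple functions this is a common refinement, from
    which additivity follows. *)
Lemma simple_integral_comp (W : choiceType) (p : T -> W) (u : W -> V) :
  is_simple p ->
  simple_integral mu D (fun t => u (p t)) =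
  \sum_(w \in range p) (m (p @^-1` [set w]))%:C *: u w.
Proof.
move=> sp; have [fp mp] := sp; have [fup mup] := is_simple_comp u sp.
rewrite /simple_integral.
transitivity (\sum_(v \in range (fun t => u (p t))) \sum_(w \in range p)
    if w \in u @^-1` [set v] then (m (p @^-1` [set w]))%:C *: u w else 0).
  apply: eq_fsbigr => v _; rewrite -fsbig_mkcondr.
  set J := range p `&` _.
  have fJ : finite_set J by exact: finite_setIl.
  have -> : mu (D `&` (fun t => u (p t)) @^-1` [set v]) =
      (\sum_(w \in J) m (p @^-1` [set w]))%:E.
    rewrite -fsumEFin//.
    under eq_fsbigr do rewrite -fin_num_measureI//.
    rewrite -measure_fin_bigcup//; last 2 first.
    - move=> w1 w2 _ _ [t [[_ /= <-] [_ /= <-]]] //.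
    - by move=> w _; exact: measurableI.
    congr (mu _); apply/seteqP; split=> [t [Dt /= e]|t [w [_ /= uw] [Dt /= pt]]].
      by exists (p t) => //; split=> //; exists t.
    by split=> //=; rewrite pt.
  rewrite /= !fsbig_finite// rmorph_sum scaler_suml big_seq [RHS]big_seq.
  apply: eq_bigr => w; rewrite in_fset_set// inE => -[_ /= <-] //.
rewrite exchange_fsbig//; apply: eq_fsbigr => w /set_mem [t _ <-].
rewrite (fsbigD1 (u (p t)))//=; last by exists t.
rewrite ifT ?inE// fsbig1 ?addr0// => v [_ /= vw]; rewrite ifF//.
by apply/negbTE; rewrite notin_setE /=; exact/nesym.
Qed.

Lemma simple_integralE (s : T -> V) : simple_integral mu D s =
  \sum_(w \in range s) (m (s @^-1` [set w]))%:C *: w.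
Proof. by []. Qed.

Lemma simple_integralD (s s' : T -> V) : is_simple s -> is_simple s' ->
  simple_integral mu D (fun t => s t + s' t) =
  simple_integral mu D s + simple_integral mu D s'.
Proof.
move=> ss ss'; have sp := is_simple_pair ss ss'; have [fp _] := sp.
rewrite (simple_integral_comp (fun p => p.1 + p.2) sp).
rewrite (simple_integral_comp (fun p => p.1) sp).
rewrite (simple_integral_comp (fun p => p.2) sp).
rewrite !fsbig_finite// -big_split/=; apply: eq_bigr => w _.
by rewrite scalerDr.
Qed.

Lemma integral_rnorm_simple (s : T -> V) : is_simple s ->
  (\int[mu]_(t in D) (rnorm (s t))%:E)%E =
  (\sum_(w \in range s) m (s @^-1` [set w]) * rnorm w)%:E.
Proof.
move=> [fs ms].
rewrite (eq_integral (fun t => \sum_(w \in range s)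
    ((rnorm w)%:E * (\1_(s @^-1` [set w]) t)%:E))%E); last first.
  move=> t _; rewrite (fsbigD1 (s t))//=; last by exists t.
  rewrite indicE mem_set//= mule1 fsbig1 ?adde0// => w [_ /= ws].
  by rewrite indicE memNset ?mule0//=; exact/nesym.
rewrite ge0_integral_fsum//; last 2 first.
- move=> w; apply: emeasurable_funM; first exact: measurable_cst.
  exact/measurable_EFinP/measurable_indic.
- by move=> w t _; rewrite mule_ge0 ?lee_fin ?rnorm_ge0.
rewrite -fsumEFin//; apply: eq_fsbigr => w _.
rewrite ge0_integralZl//; last 2 first.
- exact/measurable_EFinP/measurable_indic.
- by rewrite lee_fin rnorm_ge0.
by rewrite integral_indic// setIC fin_num_measureI// -EFinM mulrC.
Qed.

Lemma rnorm_simple_integral (s : T -> V) : is_simple s ->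
  ((rnorm (simple_integral mu D s))%:E <= \int[mu]_(t in D) (rnorm (s t))%:E)%E.
Proof.
move=> ss; have [fs _] := ss.
rewrite integral_rnorm_simple// lee_fin simple_integralE !fsbig_finite//.
rewrite (le_trans (rnorm_sum _ _ _))// ler_sum// => w _.
by rewrite rnormZr ger0_norm// fine_ge0.
Qed.

End simple_integral_theory.

Lemma simple_integral_brl d (T : measurableType d) (R : realType)
    (V V' : completeNormedModType R[i]) (mu : {measure set T -> \bar R})
    (D : set T) (L : V -> V') (s : T -> V) :
  measurable D -> (mu D < +oo)%E -> bounded_real_linear L -> is_simple s ->
  simple_integral mu D (fun t => L (s t)) = L (simple_integral mu D s).
Proof.
move=> mD muD LP ss; have [fs _] := ss; have [LD LZ _] := LP.
rewrite simple_integral_comp// /simple_integral !fsbig_finite//.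
rewrite (big_morph L LD (brl0 LP)).
by apply: eq_bigr => w _; rewrite LZ.
Qed.

(** * The Bochner integral *)

Section dominated_functions.
Context {d} {T : measurableType d} {R : realType} (mu : {measure set T -> \bar R}).
Implicit Types (D F : set T) (h : T -> R).

(* An upper bound for the upper integral of [h]. *)
Definition dominated D h (e : R) := exists g : T -> \bar R,
  [/\ measurable_fun D g, forall t, D t -> (0 <= g t)%E,
      forall t, D t -> ((h t)%:E <= g t)%E
    & (\int[mu]_(t in D) g t <= e%:E)%E].

Lemma dominated0 D h : (forall t, D t -> h t <= 0) -> dominated D h 0.
Proof.
move=> h0; exists (cst 0%E); split; first exact: measurable_cst.
- by [].
- by move=> t /h0; rewrite lee_fin.
- by rewrite integral0.
Qed.

Lemma dominated_le D h h' e e' : e <= e' -> (forall t, D t -> h' t <= h t) ->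
  dominated D h e -> dominated D h' e'.
Proof.
move=> ee' hh' [g [mg g0 hg ig]]; exists g; split=> //.
- by move=> t Dt; rewrite (le_trans _ (hg t Dt))// lee_fin hh'.
- by rewrite (le_trans ig)// lee_fin.
Qed.

Lemma dominatedD D h h' e e' : measurable D -> dominated D h e ->
  dominated D h' e' -> dominated D (fun t => h t + h' t) (e + e').
Proof.
move=> mD [g [mg g0 hg ig]] [g' [mg' g'0 hg' ig']].
exists (fun t => (g t + g' t)%E); split.
- exact: emeasurable_funD.
- by move=> t Dt; rewrite adde_ge0 ?g0 ?g'0.
- by move=> t Dt; rewrite EFinD leeD ?hg ?hg'.
- by rewrite ge0_integralD// EFinD leeD.
Qed.

Lemma dominatedM D h e (k : R) : measurable D -> 0 <= k ->
  dominated D h e -> dominated D (fun t => k * h t) (k * e).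
Proof.
move=> mD k0 [g [mg g0 hg ig]]; exists (fun t => (k%:E * g t)%E); split.
- by apply: emeasurable_funM => //; exact: measurable_cst.
- by move=> t Dt; rewrite mule_ge0 ?lee_fin ?g0.
- by move=> t Dt; rewrite EFinM lee_wpmul2l ?lee_fin ?hg.
- by rewrite ge0_integralZl// EFinM lee_wpmul2l ?lee_fin.
Qed.

Lemma dominatedS D D' h e : measurable D -> measurable D' -> D' `<=` D ->
  dominated D h e -> dominated D' h e.
Proof.
move=> mD mD' D'D [g [mg g0 hg ig]]; exists g; split.
- exact: measurable_funS mg.
- by move=> t /D'D; exact: g0.
- by move=> t /D'D; exact: hg.
- by apply: le_trans ig; apply: ge0_subset_integral.
Qed.

Lemma dominated_patch D F h e : measurable D -> measurable F ->
  dominated (D `&` F) h e -> dominated D (fun t => if t \in F then h t else 0) e.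
Proof.
move=> mD mF [g [mg g0 hg ig]]; exists (g \_ F); split.
- exact/measurable_restrict.
- by move=> t Dt; rewrite patchE; case: ifPn => [/set_mem Ft|//]; exact: g0.
- by move=> t Dt; rewrite patchE; case: ifPn => [/set_mem Ft|//]; exact: hg.
- by rewrite -integral_mkcondr.
Qed.

End dominated_functions.

(** * Bochner integrals through simple approximations *)

Section bochner_criterion.
Context {d} {T : measurableType d} {R : realType}.
Context {V : completeNormedModType R[i]} (mu : {measure set T -> \bar R}).
Local Open Scope complex_scope.
Implicit Types (D F : set T) (f s : T -> V) (I : V).

Lemma is_simple_dominated D s : measurable D -> (mu D < +oo)%E -> is_simple s ->
  exists2 c : R, 0 <= c & dominated mu D (fun t => rnorm (s t)) c.
Proof.
move=> mD muD ss; exists (fine (\int[mu]_(t in D) (rnorm (s t))%:E)%E).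
  by rewrite fine_ge0// integral_ge0// => t _; rewrite lee_fin rnorm_ge0.
exists (fun t => (rnorm (s t))%:E); split=> //.
- exact: (@is_simple_measurable_fun _ _ _ _ _ _ (fun v : V => (rnorm v)%:E) _ ss).
- by move=> t _; rewrite lee_fin rnorm_ge0.
- by rewrite integral_rnorm_simple.
Qed.

Lemma dominated_simple_integral D s e : measurable D -> (mu D < +oo)%E ->
  is_simple s -> dominated mu D (fun t => rnorm (s t)) e ->
  rnorm (simple_integral mu D s) <= e.
Proof.
move=> mD muD ss [g [mg g0 sg ig]]; rewrite -lee_fin.
rewrite (le_trans (rnorm_simple_integral mD muD ss))// (le_trans _ ig)//.
by apply: ge0_le_lower_integral => // t _; rewrite lee_fin rnorm_ge0.
Qed.

Definition approx_simple D f s (e : R) :=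
  is_simple s /\ dominated mu D (fun t => rnorm (f t - s t)) e.

(* A reformulation of [is_bochner_integral] without sequences or exceptional
   null sets, see [bochner_intP]. *)
Definition bochner_int D f I := forall e : R, 0 < e ->
  exists s, approx_simple D f s e /\ rnorm (simple_integral mu D s - I) <= e.

Lemma approx_simple_le D f s e e' : e <= e' ->
  approx_simple D f s e -> approx_simple D f s e'.
Proof. by move=> ee' [ss df]; split=> //; exact: dominated_le df. Qed.

Lemma bochner_int_ext D f f' I : (forall t, D t -> f t = f' t) ->
  bochner_int D f I -> bochner_int D f' I.
Proof.
move=> ff' h e /h[s [[ss df] sI]]; exists s; split=> //; split=> //.
by apply: dominated_le df => // t Dt; rewrite ff'.
Qed.

Section fixed_domain.
Variable D : set T.
Hypotheses (mD : measurable D) (muD : (mu D < +oo)%E).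

Lemma simple_integralB s s' : is_simple s -> is_simple s' ->
  simple_integral mu D (fun t => s t - s' t) =
  simple_integral mu D s - simple_integral mu D s'.
Proof.
move=> ss ss'; rewrite (simple_integralD mD muD ss (is_simple_comp -%R ss')).
congr (_ + _); apply: (simple_integral_brl mD muD _ ss').
split=> [u v|r v|]; rewrite ?opprD ?scalerN//.
by exists 1 => // v; rewrite rnormN mul1r.
Qed.

Lemma approx_simple_dist f f' s s' e e' c : approx_simple D f s e ->
  approx_simple D f' s' e' -> dominated mu D (fun t => rnorm (f t - f' t)) c ->
  rnorm (simple_integral mu D s - simple_integral mu D s') <= e + e' + c.
Proof.
move=> [ss df] [ss' df'] dff'; rewrite -simple_integralB//.
apply: dominated_simple_integral => //.
  exact: (is_simple_comp (fun p => p.1 - p.2) (is_simple_pair ss ss')).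
apply: dominated_le (dominatedD mD (dominatedD mD df df') dff') => // t _.
have := rnorm_triangle (s t) (f t) (s' t).
by have := rnorm_triangle (f t) (f' t) (s' t); rewrite (rnormB (s t) (f t)); lra.
Qed.

Lemma bochner_int_dist f f' I I' c : bochner_int D f I -> bochner_int D f' I' ->
  dominated mu D (fun t => rnorm (f t - f' t)) c -> rnorm (I - I') <= c.
Proof.
move=> fI f'I' dff'; apply/ler_addgt0Pr => e e0.
have e40 : 0 < e / 4 by rewrite divr_gt0.
have [s [sa sI]] := fI _ e40; have [s' [sa' sI']] := f'I' _ e40.
have := approx_simple_dist sa sa' dff'.
set S := simple_integral mu D s; set S' := simple_integral mu D s'.
have := rnorm_triangle I S I'; have := rnorm_triangle S S' I'.
by rewrite (rnormB I S) -/S -/S' in sI sI' *; lra.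
Qed.

Lemma bochner_int_unique f I I' :
  bochner_int D f I -> bochner_int D f I' -> I = I'.
Proof.
move=> fI fI'; apply/eqP; rewrite -subr_eq0 -rnorm_eq0 eq_le rnorm_ge0 andbT.
apply: (bochner_int_dist fI fI'); apply: dominated0 => t _.
by rewrite subrr rnorm0.
Qed.

Lemma bochner_int_ex f : (forall e : R, 0 < e -> exists s, approx_simple D f s e) ->
  exists I, bochner_int D f I.
Proof.
move=> h; pose q : R := 2^-1.
have q0 n : 0 < q ^+ n by rewrite exprn_gt0// invr_gt0.
have /choice[s hs] n : exists s, approx_simple D f s (q ^+ n) by exact: h.
(* Consecutive integrals differ by at most q^(n+1) + q^n, which is below 2 q^n. *)
have [||I hI] := @geometric_cvg R V (fun n => simple_integral mu D (s n)) 2 q.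
- by rewrite /q; lra.
- move=> n; have h0 : dominated mu D (fun t => rnorm (f t - f t)) 0.
    by apply: dominated0 => t _; rewrite subrr rnorm0.
  have := approx_simple_dist (hs n.+1) (hs n) h0.
  by rewrite exprS; have := q0 n; rewrite /q; lra.
exists I => e e0.
move/cvg_rnorm_fmapP : hI => /(_ e e0)[N _ hN].
have : q ^+ n @[n --> \oo] --> 0.
  by apply: cvg_expr; rewrite ger0_norm /q; lra.
move=> /cvgrPdist_lt/(_ _ e0)[M _ hM].
have hle := leq_maxl N M; have hle' := leq_maxr N M.
exists (s (maxn N M)); split; last exact/ltW/hN.
apply: approx_simple_le (hs _).
by have := hM _ hle'; rewrite /= sub0r normrN gtr0_norm// => /ltW.
Qed.

Lemma bochner_int_lim f : (forall e : R, 0 < e -> exists f' I',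
    bochner_int D f' I' /\ dominated mu D (fun t => rnorm (f t - f' t)) e) ->
  exists I, bochner_int D f I.
Proof.
move=> h; apply: bochner_int_ex => e e0.
have e20 : 0 < e / 2 by rewrite divr_gt0.
have [f' [I' [f'I' df]]] := h _ e20; have [s [[ss ds] _]] := f'I' _ e20.
exists s; split=> //; rewrite (splitr e).
by apply: dominated_le (dominatedD mD df ds) => // t _; exact: rnorm_triangle.
Qed.

Lemma bochner_int0 : bochner_int D (fun=> 0) 0.
Proof.
move=> e e0; exists (fun=> 0).
have ss : is_simple (fun _ : T => 0 : V).
  split=> [|v]; first exact: finite_image_cst.
  by rewrite (preimage_cst (0 : V)); case: ifP.
split; first split => //.
  have d0 : dominated mu D (fun=> 0 : R) 0 by exact: dominated0.
  by apply: dominated_le (ltW e0) _ d0 => t _; rewrite subrr rnorm0.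
rewrite subr0 (le_trans _ (ltW e0))//; apply: dominated_simple_integral => //.
by apply: dominated0 => t _; rewrite rnorm0.
Qed.

Lemma bochner_intD f f' I I' : bochner_int D f I -> bochner_int D f' I' ->
  bochner_int D (fun t => f t + f' t) (I + I').
Proof.
move=> fI f'I' e e0; have e20 : 0 < e / 2 by rewrite divr_gt0.
have [s [[ss ds] sI]] := fI _ e20; have [s' [[ss' ds'] sI']] := f'I' _ e20.
exists (fun t => s t + s' t); split; first split.
- exact: (is_simple_comp (fun p => p.1 + p.2) (is_simple_pair ss ss')).
- rewrite (splitr e); apply: dominated_le (dominatedD mD ds ds') => // t _.
  by rewrite opprD addrACA rnormD.
- rewrite simple_integralD// opprD addrACA (le_trans (rnormD _ _))//.
  by rewrite (splitr e) lerD.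
Qed.

Lemma bochner_int_sum (J : Type) (r : seq J) (f : J -> T -> V) (I : J -> V) :
  (forall j, bochner_int D (f j) (I j)) ->
  bochner_int D (fun t => \sum_(j <- r) f j t) (\sum_(j <- r) I j).
Proof.
move=> h; elim: r => [|j r ih].
  by rewrite big_nil; apply: bochner_int_ext bochner_int0 => t _; rewrite big_nil.
rewrite big_cons; apply: bochner_int_ext (bochner_intD (h j) ih) => t _.
by rewrite big_cons.
Qed.

Lemma bochner_int_dominated f I : bochner_int D f I ->
  exists2 c : R, 0 <= c & dominated mu D (fun t => rnorm (f t)) c.
Proof.
move=> /(_ 1 ltr01)[s [[ss ds] _]].
have [c c0 dc] := is_simple_dominated mD muD ss.
exists (1 + c); first by rewrite addr_ge0.
apply: dominated_le (dominatedD mD ds dc) => // t _.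
by have := rnorm_triangle (f t) (s t) 0; rewrite !subr0.
Qed.

Lemma bochner_int_norm f I c : bochner_int D f I ->
  dominated mu D (fun t => rnorm (f t)) c -> rnorm I <= c.
Proof.
move=> fI df; rewrite -(subr0 I); apply: (bochner_int_dist fI bochner_int0).
by apply: dominated_le df => // t _; rewrite subr0.
Qed.

(** Extension by zero brings integrals over different subsets to the common domain D, where they can
    be added. *)
Lemma bochner_int_patch F f I : measurable F -> bochner_int (D `&` F) f I ->
  bochner_int D (fun t => if t \in F then f t else 0) I.
Proof.
move=> mF fI e /fI[s [[ss ds] sI]].
have sF := is_simple_pair ss (is_simple_mem mF).
pose u (p : V * bool) := if p.2 then p.1 else 0.
have muDF : (mu (D `&` F) < +oo)%E.
  by rewrite (le_lt_trans _ muD)//; apply: le_measure; rewrite ?inE//; exact: measurableI.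
exists (fun t => u (s t, t \in F)); split; first split.
- exact: (is_simple_comp u sF).
- apply: dominated_le (dominated_patch mD mF ds) => // t Dt.
  by rewrite /u /=; case: ifPn => //; rewrite subrr rnorm0.
- suff -> : simple_integral mu D (fun t => u (s t, t \in F)) =
      simple_integral mu (D `&` F) s by [].
  (* Both sides become sums over the fibres of the pair (s, indicator of F). For pairs (v, false)
     the value is 0 on the left and the fibre in [D] and [F] is empty on the right. *)
  rewrite (simple_integral_comp mD muD u sF).
  rewrite (simple_integral_comp (measurableI _ _ mD mF) muDF (fun p => p.1) sF).
  apply: eq_fsbigr => -[v b] _ /=; case: b.
    congr ((fine (mu _))%:C *: v); rewrite -setIA; congr (_ `&` _).
    apply/seteqP; split=> [t /= [-> tF]|t [_]//]; split; rewrite ?tF//.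
    exact/set_mem.
  rewrite scaler0 (_ : D `&` F `&` _ = set0) ?measure0 ?scale0r//.
  by apply/seteqP; split=> // t [[_ /mem_set Ft] /= []]; rewrite Ft.
Qed.

End fixed_domain.

Lemma bochner_int_setU D1 D2 f I I1 I2 : measurable D1 -> measurable D2 ->
  (mu D1 < +oo)%E -> (mu D2 < +oo)%E -> D1 `&` D2 = set0 ->
  bochner_int (D1 `|` D2) f I -> bochner_int D1 f I1 -> bochner_int D2 f I2 ->
  I = I1 + I2.
Proof.
move=> mD1 mD2 mu1 mu2 D12 fI fI1 fI2.
have mU := measurableU _ _ mD1 mD2.
have muU : (mu (D1 `|` D2) < +oo)%E.
  by rewrite (le_lt_trans (measureU2 _ _ _))// lte_add_pinfty.
apply: (bochner_int_unique mU muU fI).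
apply: (bochner_int_ext (f := fun t => (if t \in D1 then f t else 0) +
  (if t \in D2 then f t else 0))).
  move=> t Dt; case: ifPn => [/set_mem D1t|].
    rewrite ifF ?addr0//; apply/negbTE; rewrite notin_setE => D2t.
    by have : (D1 `&` D2) t by []; rewrite D12.
  rewrite notin_setE add0r => nD1t; rewrite ifT// inE.
  by case: Dt.
apply: bochner_intD => //; apply: bochner_int_patch => //.
  by rewrite setIC setIidl//; exact: subsetUl.
by rewrite setIC setIidl//; exact: subsetUr.
Qed.

End bochner_criterion.

Lemma bochner_int_brl d (T : measurableType d) (R : realType)
    (V V' : completeNormedModType R[i]) (mu : {measure set T -> \bar R})
    (D : set T) (f : T -> V) (L : V -> V') (I : V) :
  measurable D -> (mu D < +oo)%E -> bounded_real_linear L ->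
  bochner_int mu D f I -> bochner_int mu D (fun t => L (f t)) (L I).
Proof.
move=> mD muD LP fI e e0; have [LD LZ [C C0 hC]] := LP.
have C1 : 0 < C + 1 by rewrite ltr_wpDl.
have [s [[ss ds] sI]] := fI _ (divr_gt0 e0 C1).
exists (fun t => L (s t)); split; first split.
- exact: is_simple_comp.
- apply: dominated_le (dominatedM mD (ltW C1) ds); first by rewrite mulrC divfK// gt_eqF.
  move=> t _; rewrite -(brlB _ _ LP) (le_trans (hC _))// ler_wpM2r ?rnorm_ge0//.
  by rewrite lerDl.
- rewrite simple_integral_brl// -(brlB _ _ LP) (le_trans (hC _))//.
  move: sI; rewrite ler_pdivlMr// mulrC; apply: le_trans.
  by rewrite ler_wpM2r ?rnorm_ge0// lerDl.
Qed.

(** * Agreement with the sequential definition, and multiplication by a function *)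

Section bochner_integral_criterion.
Context {d} {T : measurableType d} {R : realType}.
Context {V : completeNormedModType R[i]} (mu : {measure set T -> \bar R}).
Local Open Scope complex_scope.
Variable D : set T.
Hypotheses (mD : measurable D) (muD : (mu D < +oo)%E).
Implicit Types (f : T -> V) (I : V).

Lemma integrable_simpleP (s : T -> V) : integrable_simple mu D s <-> is_simple s.
Proof.
split=> [[fs ms _]//|[fs ms]]; split=> // v _.
rewrite (le_lt_trans _ muD)//; apply: le_measure; rewrite ?inE//.
exact: measurableI.
Qed.

Lemma rnorm_dist (u v : V) : `|rnorm u - rnorm v| <= rnorm (u - v).
Proof.
have h (a b : V) : rnorm a - rnorm b <= rnorm (a - b).
  by rewrite lerBlDr; have := rnorm_triangle a b 0; rewrite !subr0.
by rewrite ler_norml h andbT lerNl opprB (rnormB u) h.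
Qed.

(** A single late term of the sequence approximates f well enough; what has to be found is a
    measurable majorant of its error. *)
Lemma is_bochner_integral_bochner_int f I :
  is_bochner_integral mu D f I -> bochner_int mu D f I.
Proof.
move=> [s [hs [N [mN muN0 subN]] h0 hI]] e e0.
have ss n : is_simple (s n) by exact/integrable_simpleP.
have [n [hn1 hn2]] : exists n,
    (\int[mu]_(t in D) (rnorm (f t - s n t))%:E <= e%:E)%E /\
    rnorm (simple_integral mu D (s n) - I) <= e.
  move/cvg_rnorm_fmapP : hI => /(_ e e0)[M _ hM].
  have : \forall n \near \oo, (\int[mu]_(t in D) (rnorm (f t - s n t))%:E < e%:E)%E.
    apply: (h0 [set x | (x < e%:E)%E]).
    by apply: open_nbhs_nbhs; split; [exact: open_ereal_lt_ereal|rewrite /= lte_fin].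
  move=> [M' _ hM']; exists (maxn M M'); split; apply: ltW.
    exact/hM'/leq_maxr.
  exact/hM/leq_maxl.
exists (s n); split=> //; split=> //.
have sN := is_simple_mem mN.
(* The value +oo dominates the error on the null set N, where nothing is known about f. On D the
   function is a pointwise limit, as m grows, of the simple functions built from |s_m - s_n|, hence
   measurable. *)
pose g t := if t \in N then +oo%E else (rnorm (f t - s n t))%:E.
have g0 t : (0 <= g t)%E by rewrite /g; case: ifP => //; rewrite lee_fin rnorm_ge0.
have mg : measurable_fun D g.
  apply: (emeasurable_fun_cvg (fun m t =>
      if t \in N then +oo%E else (rnorm (s m t - s n t))%:E)).
    move=> m.
    exact: (@is_simple_measurable_fun _ _ _ _ _ _
      (fun p : V * V * bool => if p.2 then +oo%E else (rnorm (p.1.1 - p.1.2))%:E)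
      _ (is_simple_pair (is_simple_pair (ss m) (ss n)) sN)).
  move=> t Dt; rewrite /g; have [tN|tN] := boolP (t \in N); first exact: cvg_cst.
  have st : s m t @[m --> \oo] --> f t.
    apply: contrapT => nst; move: tN; rewrite notin_setE; apply; apply: subN => /=.
    by move=> /(_ Dt).
  apply: cvg_EFin; first by near=> m.
  apply/cvgrPdist_lt => r r0.
  move/cvg_rnorm_fmapP : st => /(_ r r0); apply: filterS => m /=.
  apply: le_lt_trans; apply: le_trans (rnorm_dist _ _) _.
  by rewrite opprB addrA subrK rnormB.
exists g; split=> //.
  move=> t Dt; rewrite /g; case: ifP => // _; exact: leey.
rewrite (ge0_negligible_integral mN)// setDE integral_mkcondr.
apply: le_trans hn1; apply: ge0_le_lower_integral => t Dt.
  by rewrite patchE; case: ifP.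
rewrite patchE; case: ifPn => [/set_mem nN|_]; last by rewrite lee_fin rnorm_ge0.
by rewrite /g ifF//; apply/negbTE; rewrite notin_setE.
Unshelve. all: by end_near. Qed.

(** Approximations with summable errors converge almost everywhere as well as in mean. *)
Lemma bochner_int_is_bochner_integral f I :
  bochner_int mu D f I -> is_bochner_integral mu D f I.
Proof.
move=> fI; pose q n : R := 1 / (2 ^ (n + 1))%:R.
have q0 n : 0 < q n by rewrite divr_gt0// ltr0n expn_gt0.
have qe (e : R) : 0 < e -> \forall n \near \oo, q n < e.
  move=> e0; have h : eseries (fun k => (q k)%:E) @ \oo --> (1 / 2 ^+ 0)%:E.
    exact: cvg_geometric_eseries_half.
  have : (2^-1 : R) ^+ n @[n --> \oo] --> (0 : R).
    by apply: cvg_expr; rewrite ger0_norm; lra.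
  move=> /cvgrPdist_lt/(_ _ e0); apply: filterS => n /=.
  have q2 : 0 <= 2^-1 ^+ n :> R by rewrite exprn_ge0// invr_ge0.
  rewrite sub0r normrN ger0_norm//; apply: le_lt_trans.
  by rewrite /q div1r natrX -exprVn exprD ler_piMr// expr1; lra.
have /choice[s hs] n : exists s, approx_simple mu D f s (q n) /\
    rnorm (simple_integral mu D s - I) <= q n by exact: fI.
have /choice[g hg] n : exists g : T -> \bar R, [/\ measurable_fun D g,
    forall t, D t -> (0 <= g t)%E,
    forall t, D t -> ((rnorm (f t - s n t))%:E <= g t)%E
    & (\int[mu]_(t in D) g t <= (q n)%:E)%E].
  by have [[_ [g hg]] _] := hs n; exists g.
exists s; split.
- by move=> n; apply/integrable_simpleP; have [[]] := hs n.
(* The sum of the majorants has finite integral, so it is finite almost everywhere; where it is, its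
   tails tend to 0, and the tail from n dominates |f - s_n|. *)
- pose S t := (\sum_(0 <= n <oo) g n t)%E.
  have mS : measurable_fun D S.
    by apply: ge0_emeasurable_sum => [k t Dt _|k _]; case: (hg k) => // _ /(_ _ Dt).
  have S0 t : D t -> (0 <= S t)%E.
    by move=> Dt; apply: nneseries_ge0 => n _ _; case: (hg n) => _ /(_ _ Dt).
  have : mu.-integrable D S.
    apply/integrableP; split => //.
    rewrite (eq_integral S); last by move=> t /set_mem Dt; rewrite gee0_abs// S0.
    rewrite integral_nneseries//; last 2 first.
    - by move=> n; case: (hg n).
    - by move=> n t Dt; case: (hg n) => _ /(_ _ Dt).
    apply: (@le_lt_trans _ _ (\sum_(0 <= n <oo) (q n)%:E)%E).
      apply: lee_nneseries => n _; last by case: (hg n).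
      by move=> _; apply: integral_ge0 => t Dt; case: (hg n) => _ /(_ _ Dt).
    have /cvg_lim -> // := @cvg_geometric_eseries_half R 1 0.
    exact: ltry.
  move=> /(integrable_ae mD); apply: filterS => t + Dt => /(_ Dt) fS.
  have gt0 n : (0 <= g n t)%E by case: (hg n) => _ /(_ _ Dt).
  have : (\sum_(0 <= n <oo) g n t < +oo)%E by rewrite -ge0_fin_numE// S0.
  move=> /nneseries_tail_cvg/(_ (fun k _ => gt0 k)) tail.
  apply/cvg_rnorm_fmapP => e e0.
  have : \forall N \near \oo, (\sum_(N <= k <oo) g k t < e%:E)%E.
    apply: (tail [set x | (x < e%:E)%E]).
    by apply: open_nbhs_nbhs; split; [exact: open_ereal_lt_ereal|rewrite /= lte_fin].
  apply: filterS => n hn; rewrite -lte_fin rnormB.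
  apply: le_lt_trans hn; case: (hg n) => _ _ /(_ _ Dt) h _.
  apply: le_trans h _.
  have := @nneseries_lim_ge R (fun k => g k t) xpredT n n.+1 (fun k _ _ => gt0 k).
  by rewrite big_nat1.
- have hq : (q n)%:E @[n --> \oo] --> 0%E.
    apply: cvg_EFin; first by near=> n.
    apply/cvgrPdist_lt => e /qe; apply: filterS => n.
    by rewrite sub0r normrN gtr0_norm.
  apply: (squeeze_cvge _ (cvg_cst 0%E) hq); near=> n; apply/andP; split.
    by apply: integral_ge0 => t _; rewrite lee_fin rnorm_ge0.
  case: (hg n) => mg g0 fg ig; apply: le_trans ig.
  by apply: ge0_le_lower_integral => // t _; rewrite lee_fin rnorm_ge0.
- apply/cvg_rnorm_fmapP => e /qe; apply: filterS => n.
  by apply: le_lt_trans; case: (hs n).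
Unshelve. all: by end_near. Qed.

Lemma bochner_intP f I : bochner_int mu D f I <-> is_bochner_integral mu D f I.
Proof.
by split; [exact: bochner_int_is_bochner_integral|
           exact: is_bochner_integral_bochner_int].
Qed.

Lemma bochner_integralP f : bochner_integrable mu D f ->
  bochner_int mu D f (bochner_integral mu D f).
Proof. by move=> h; apply/bochner_intP; exact: xgetPex. Qed.

Lemma bochner_integralE f I : bochner_int mu D f I -> bochner_integral mu D f = I.
Proof.
move=> fI; apply: (bochner_int_unique mD muD _ fI); apply: bochner_integralP.
by exists I; exact/bochner_intP.
Qed.

(** The sum counts the integers among 1, ..., n that are at most x, so for x <= n it is the integer
    part of x. The first half carries the induction for the second. *)
Lemma count_floor (x : R) n : 0 <= x ->
  (n%:R <= x -> \sum_(j < n) ((j.+1%:R <= x)%R)%:R = n%:R :> R) /\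
  (x <= n%:R -> x - 1 <= \sum_(j < n) ((j.+1%:R <= x)%R)%:R <= x).
Proof.
move=> x0; elim: n => [|n [ih1 ih2]].
  by rewrite big_ord0; split=> // h; apply/andP; split; lra.
rewrite big_ord_recr/= -natr1; split=> h.
  by rewrite h ih1//; lra.
have [nx|nx] := leP n%:R x.
  rewrite ih1//; case: (leP (n%:R + 1) x) => h2; apply/andP; split; rewrite ?mulr1n ?mulr0n; lra.
have /andP[h1 h2] := ih2 (ltW nx).
by rewrite (lt_geF (lt_le_trans nx _)) ?lerDl// addr0 h1 h2.
Qed.

(* [phi] is within [1/n] of the average of the indicators of the sets
   [phi >= j/n], so [phi f] integrates to a limit of averages of integrals of
   [f] over measurable subsets. *)
Lemma bochner_int_mul f (phi : T -> R) (c : R) : measurable_fun setT phi ->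
  (forall t, 0 <= phi t <= 1) -> bochner_integrable mu D f ->
  (forall F, measurable F -> F `<=` D ->
    exists I, bochner_int mu F f I /\ rnorm I <= c) ->
  exists I, bochner_int mu D (fun t => (phi t)%:C *: f t) I /\ rnorm I <= c.
Proof.
move=> mphi phi01 [I0 /bochner_intP fI0] hF.
have [c0 c00 df] := bochner_int_dominated mD muD fI0.
have step (e : R) : 0 < e -> exists f' I', [/\ bochner_int mu D f' I',
    dominated mu D (fun t => rnorm ((phi t)%:C *: f t - f' t)) e & rnorm I' <= c].
  (* The averages approximate phi within 1/n, which costs c0/n in the integral; this n makes c0/n at
     most e. *)
  move=> e0; pose n := (Num.bound (c0 / e)).+1.
  have n0 : 0 < n%:R :> R by rewrite ltr0n.
  have ne : n%:R^-1 * c0 <= e.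
    rewrite mulrC ler_pdivrMr// mulrC -ler_pdivrMr//.
    by have := archi_boundP (divr_ge0 c00 (ltW e0)); rewrite /n -natr1; lra.
  pose F (j : 'I_n) := [set t | j.+1%:R <= n%:R * phi t].
  have mF j : measurable (F j).
    rewrite (_ : F j = setT `&` phi @^-1` `[j.+1%:R / n%:R, +oo[%classic).
      exact: mphi.
    rewrite setTI; apply/seteqP; split=> t /=;
      by rewrite in_itv/= andbT ler_pdivrMr// mulrC.
  have /choice[J hJ] j : exists I, bochner_int mu (D `&` F j) f I /\ rnorm I <= c.
    by apply: hF; [exact: measurableI|exact: subIsetl].
  exists (fun t => \sum_(j < n) n%:R^-1%:C *: (if t \in F j then f t else 0)).
  exists (\sum_(j < n) n%:R^-1%:C *: J j); split.
  - apply: bochner_int_sum => // j; apply: bochner_int_brl => //.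
      split=> [u v|r v|]; rewrite ?scalerDr// ?scalerA ?[_ * r%:C]mulrC//.
      exists n%:R^-1; first by rewrite invr_ge0 ltW.
      by move=> v; rewrite rnormZr ger0_norm// invr_ge0 ltW.
    by apply: bochner_int_patch => //; case: (hJ j).
  - apply: dominated_le ne _ (dominatedM mD _ df); last by rewrite invr_ge0 ltW.
    move=> t _.
    have -> : \sum_(j < n) n%:R^-1%:C *: (if t \in F j then f t else 0) =
        (n%:R^-1 * \sum_(j < n) ((j.+1%:R <= n%:R * phi t)%R)%:R)%:C *: f t.
      rewrite rmorphM/= -scalerA rmorph_sum/= scaler_suml scaler_sumr.
      apply: eq_bigr => j _; congr (_ *: _).
      have -> : (t \in F j) = (j.+1%:R <= n%:R * phi t).
        by apply/idP/idP => [/set_mem|/mem_set].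
      by case: ifP => _; rewrite ?scale1r ?scale0r.
    rewrite -scalerBl -rmorphB/= rnormZr ler_wpM2r ?rnorm_ge0//.
    have /andP[p0 p1] := phi01 t.
    have nphi0 : 0 <= n%:R * phi t by rewrite mulr_ge0// ltW.
    have [_ /(_ _)/andP[|h1 h2]] := count_floor n nphi0.
      by rewrite ler_piMr// ltW.
    have nV0 : 0 <= n%:R^-1 :> R by rewrite invr_ge0 ltW.
    rewrite -[X in X - _](mulKf (lt0r_neq0 n0)) -mulrBr normrM (ger0_norm nV0).
    by apply: ler_piMr => //; rewrite ler_norml; apply/andP; split; lra.
  - rewrite (le_trans (rnorm_sum _ _ _))// (@le_trans _ _ (\sum_(j < n) n%:R^-1 * c))//.
      have nV0 : 0 <= n%:R^-1 :> R by rewrite invr_ge0 ltW.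
      apply: ler_sum => j _; rewrite rnormZr (ger0_norm nV0).
      by apply: ler_wpM2l => //; case: (hJ j).
    by rewrite sumr_const card_ord -mulrnAl -(mulr_natr n%:R^-1) mulVf ?mul1r// gt_eqF.
have [|I hI] := @bochner_int_lim _ _ _ _ mu D mD muD (fun t => (phi t)%:C *: f t).
  by move=> e /step[f' [I' [h1 h2 _]]]; exists f', I'.
exists I; split=> //; apply/ler_addgt0Pr => e /step[f' [I' [h1 h2 h3]]].
have := bochner_int_dist mD muD hI h1 h2.
by have := rnorm_triangle I I' 0; rewrite !subr0; lra.
Qed.

End bochner_integral_criterion.

(** * Measurability on the group *)

Section complex_parts.
Context {R : realType}.
Local Open Scope complex_scope.

Lemma Re_norm_le (z : R[i]) : `|complex.Re z| <= complex.Re `|z|.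
Proof.
by rewrite -lecR (RRe_real (ger0_real (normr_ge0 z))) normc_ge_Re.
Qed.

Lemma Im_norm_le (z : R[i]) : `|complex.Im z| <= complex.Re `|z|.
Proof.
have -> : complex.Im z = - complex.Re (z * 'i%C) by rewrite ReiNIm opprK.
rewrite normrN (le_trans (Re_norm_le _))// normrM.
suff -> : `|'i%C : R[i]| = 1 by rewrite mulr1.
by rewrite normc_def /= expr0n expr1n add0r sqrtr1.
Qed.

Lemma brl_scale (V : normedModType R[i]) (k : R[i]) :
  bounded_real_linear (fun v : V => k *: v).
Proof.
split=> [u v|r v|]; rewrite ?scalerDr// ?scalerA ?[_ * r%:C]mulrC//.
exists (complex.Re `|k|) => [|v]; last by rewrite rnormZ.
by rewrite -ler0c RRe_real// ger0_real.
Qed.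

(** When |z| = 1 the factors (1 + Re z)/2 and (1 + Im z)/2 lie in [0, 1], the range required by
    [bochner_int_mul]. *)
Lemma complex_unit_decomposition (V : normedModType R[i]) (z : R[i]) (v : V) :
  z *: v = 2 *: (((1 + complex.Re z) / 2)%:C *: v) +
    ((2 * 'i%C) *: (((1 + complex.Im z) / 2)%:C *: v) + (- (1 + 'i%C)) *: v).
Proof.
rewrite !scalerA -!scalerDl; congr (_ *: _).
apply/eqP; rewrite eq_complex; case: z => x y /=.
by apply/andP; split; apply/eqP; field.
Qed.

End complex_parts.

Section borel_measurability.
Context {R : realType} {G : topologicalZmodType}.

Lemma continuous_borel_measurable (h : G -> R) :
  continuous h -> measurable_fun [set: borel G] (h : borel G -> R).
Proof.
move=> /continuousP ch; apply: (measurability _ (RGenOpens.measurableE R)).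
move=> _ [_ [a [b ->] <-]]; rewrite setTI; apply: sub_sigma_algebra.
exact/ch/interval_open.
Qed.

Lemma translation_continuous (s : G) : continuous (fun t : G => s + t).
Proof.
move=> t; apply: (@cvg_comp _ _ _ (fun u : G => (s, u)) (fun z : G * G => z.1 + z.2)
  _ (nbhs (s, t))); last exact: (@add_continuous G (s, t)).
by apply: cvg_pair; [exact: cvg_cst|exact: cvg_id].
Qed.

Lemma translation_measurable (s : G) :
  measurable_fun [set: borel G] (fun t : borel G => (s + t : G) : borel G).
Proof.
apply: (@measurability _ _ (borel G) (borel G) _ _ (@open G)) => //.
move=> _ [U oU <-]; rewrite setTI; apply: sub_sigma_algebra.
by move/continuousP: (@translation_continuous s); apply.
Qed.

Lemma pairing_cvg (x : dual R G) (t : G) (e : R) : 0 < e ->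
  \forall u \near t, complex.Re `|x t - x u| < e.
Proof.
move=> e0; have := @pairing_continuous R G x t.
move=> /cvgrPdist_lt/(_ (real_complex R e)); rewrite ltcR => /(_ e0).
apply: filterS => u; rewrite ltcE /= => /andP[_].
by [].
Qed.

Lemma pairing_Re_continuous (x : dual R G) : continuous (fun t : G => complex.Re (x t)).
Proof.
move=> t; apply/cvgrPdist_lt => e /(pairing_cvg x t); apply: filterS => u.
by apply: le_lt_trans; rewrite -raddfB; exact: Re_norm_le.
Qed.

Lemma pairing_Im_continuous (x : dual R G) : continuous (fun t : G => complex.Im (x t)).
Proof.
move=> t; apply/cvgrPdist_lt => e /(pairing_cvg x t); apply: filterS => u.
by apply: le_lt_trans; rewrite -raddfB; exact: Im_norm_le.
Qed.

Lemma relatively_compact0 : relatively_compact (set0 : set G).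
Proof.
split; first exact: measurable0.
by rewrite precompactE closure0; exact: compact0.
Qed.

Lemma relatively_compactU (K L : set G) :
  relatively_compact K -> relatively_compact L -> relatively_compact (K `|` L).
Proof.
move=> [mK pK] [mL pL]; split; first exact: measurableU.
by move: pK pL; rewrite !precompactE closureU; exact: compactU.
Qed.

Lemma relatively_compactS (K L : set G) : measurable (L : set (borel G)) ->
  L `<=` K -> relatively_compact K -> relatively_compact L.
Proof. by move=> mL LK [_ pK]; split=> //; exact: precompact_subset LK pK. Qed.

Lemma relatively_compactD (K L : set G) : relatively_compact K ->
  relatively_compact L -> relatively_compact (K `\` L).
Proof.
move=> [mK pK] [mL _]; apply: relatively_compactS (conj mK pK).
  exact: measurableD.
exact: subDsetl.
Qed.

(** The translate of the closure of K is compact, hence precompact in a Hausdorff space, and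
    precompactness passes to subsets. *)
Lemma relatively_compact_translate (s : G) (K : set G) : hausdorff_space G ->
  relatively_compact K -> relatively_compact [set t | K (s + t)].
Proof.
move=> hG [mK]; rewrite precompactE => cK; split.
  have := @translation_measurable s measurableT K mK; rewrite setTI.
  exact.
apply: (@precompact_subset _ _ [set - s + t | t in closure K]).
  move=> t Kt; exists (s + t); last by rewrite addKr.
  exact: subset_closure.
apply: compact_precompact => //; apply: continuous_compact => //.
by apply: continuous_subspaceT; exact: translation_continuous.
Qed.

Global Instance relatively_compact_net_filter :
  ProperFilter (@relatively_compact_net G).
Proof.
apply: filter_from_proper; last by move=> K rK; exists K; split.
apply: filter_from_filter; first by exists set0; exact: relatively_compact0.
move=> K L rK rL; exists (K `|` L); first exact: relatively_compactU.
by move=> M /= [rM]; rewrite subUset => -[KM LM]; split.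
Qed.

End borel_measurability.

(** * Unconditional integrals *)

Section unconditional_integral_theory.
Context {R : realType} {G : topologicalZmodType}.
Context {mu : {measure set (borel G) -> \bar R}}.
Hypotheses (G_hausdorff : hausdorff_space G) (mu_haar : haar_measure mu).
Local Open Scope complex_scope.

Lemma relatively_compact_fin (K : set G) :
  relatively_compact K -> (mu (K : set (borel G)) < +oo)%E.
Proof.
case: mu_haar => _ cfin _ _ _ [mK]; rewrite precompactE => /cfin.
apply: le_lt_trans; apply: le_measure; rewrite ?inE//.
  rewrite -[closure K]setCK; apply: measurableC; apply: sub_sigma_algebra.
  exact/closed_openC/closed_closure.
exact: subset_closure.
Qed.

Section fixed_target.
Context {V : completeNormedModType R[i]}.
Implicit Types (f : G -> V) (K : set (borel G)).

Let rcm K : relatively_compact (K : set G) -> measurable K.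
Proof. by case. Qed.

(** [unconditionally_integrable] with its limit named, see [uncond_int_cvg]. Quantifying over every
    J related by [bochner_int] keeps the chosen value [bochner_integral] out of the estimates. *)
Definition uncond_int f (I : V) :=
  (forall K, relatively_compact (K : set G) -> exists J, bochner_int mu K f J) /\
  forall e : R, 0 < e -> exists K0, relatively_compact (K0 : set G) /\
    forall K J, relatively_compact (K : set G) -> K0 `<=` K ->
      bochner_int mu K f J -> rnorm (J - I) <= e.

Lemma bochner_int_rc_unique K f I J : relatively_compact (K : set G) ->
  bochner_int mu K f I -> bochner_int mu K f J -> I = J.
Proof.
by move=> rK; apply: bochner_int_unique; [exact: rcm|exact: relatively_compact_fin].
Qed.

Lemma bochner_integral_rcE K f J : relatively_compact (K : set G) ->
  bochner_int mu K f J -> bochner_integral mu K f = J.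
Proof.
by move=> rK; apply: bochner_integralE; [exact: rcm|exact: relatively_compact_fin].
Qed.

Lemma bochner_integrable_rcP K f : relatively_compact (K : set G) ->
  bochner_integrable mu K f <-> exists J, bochner_int mu K f J.
Proof.
move=> rK; have mK := rcm rK; have fK := relatively_compact_fin rK.
by split=> -[J fJ]; exists J; [exact/(bochner_intP mK fK)|exact/(bochner_intP mK fK)].
Qed.

Lemma uncond_int_cvg f I : uncond_int f I <->
  (forall K, relatively_compact (K : set G) -> bochner_integrable mu K f) /\
  bochner_integral mu (K : set (borel G)) f
    @[K --> @relatively_compact_net G] --> I.
Proof.
split=> [[fi fI]|[fi /cvg_rnorm_fmapP fI]].
  split=> [K rK|]; first by apply/bochner_integrable_rcP => //; exact: fi.
  apply/cvg_rnorm_fmapP => e e0.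
  have [K0 [rK0 hK0]] := fI _ (divr_gt0 e0 (ltr0n R 2)).
  exists K0 => //= K [rK K0K]; have [J fJ] := fi K rK.
  rewrite (bochner_integral_rcE rK fJ) (le_lt_trans (hK0 K J rK K0K fJ))//.
  by rewrite gtr_pMr// invf_lt1// ltr1n.
split=> [K rK|e /fI[K0 rK0 hK0]]; first exact/bochner_integrable_rcP/fi.
exists K0; split=> // K J rK K0K fJ.
by rewrite -(bochner_integral_rcE rK fJ) ltW//; apply: hK0.
Qed.

Lemma unconditionally_integrableP f :
  unconditionally_integrable mu f <-> exists I, uncond_int f I.
Proof.
split=> [[fi /cvg_ex[I fI]]|[I /uncond_int_cvg[fi fI]]].
  by exists I; apply/uncond_int_cvg.
by split=> //; apply/cvg_ex; exists I.
Qed.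

Lemma unconditional_integralE f I :
  uncond_int f I -> unconditional_integral mu f = I.
Proof. by move=> /uncond_int_cvg[_ fI]; apply: cvg_lim => //; exact: (@norm_hausdorff _ V). Qed.

Lemma uncond_int_ext f f' I : (forall t, f t = f' t) ->
  uncond_int f I -> uncond_int f' I.
Proof. by move=> /funext ->. Qed.

(** The integrals over K0 and over the union of K and K0 are both within e/2 of I, and the integral
    over K is their difference. *)
Lemma uncond_int_cauchy f I : uncond_int f I -> forall e : R, 0 < e ->
  exists K0, relatively_compact (K0 : set G) /\ forall K J,
    relatively_compact (K : set G) -> K `&` K0 = set0 ->
    bochner_int mu K f J -> rnorm J <= e.
Proof.
move=> [fi fI] e e0; have [K0 [rK0 h]] := fI _ (divr_gt0 e0 (ltr0n R 2)).
exists K0; split=> // K J rK KK0 fJ.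
have [J0 fJ0] := fi K0 rK0; have rU := relatively_compactU rK rK0.
have [J' fJ'] := fi _ rU.
have eJ := bochner_int_setU (rcm rK) (rcm rK0) (relatively_compact_fin rK)
  (relatively_compact_fin rK0) KK0 fJ' fJ fJ0.
have h1 := h _ _ rU (@subsetUr _ _ _) fJ'.
have h0 := h _ _ rK0 (@subset_refl _ _) fJ0.
have -> : J = J' - J0 by rewrite eJ addrK.
by have := rnorm_triangle J' I J0; rewrite (rnormB I J0); lra.
Qed.

(** Smallness off a relatively compact set, unlike convergence to a named limit, is inherited by phi
    f; this converse then produces the limit. *)
Lemma uncond_int_of_cauchy f :
  (forall K, relatively_compact (K : set G) -> exists J, bochner_int mu K f J) ->
  (forall e : R, 0 < e -> exists K0, relatively_compact (K0 : set G) /\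
    forall K J, relatively_compact (K : set G) -> K `&` K0 = set0 ->
      bochner_int mu K f J -> rnorm J <= e) ->
  exists I, uncond_int f I.
Proof.
move=> fi fc.
have [I fI] : exists I : V, bochner_integral mu (K : set (borel G)) f
    @[K --> @relatively_compact_net G] --> I.
  apply: cauchy_rnorm_cvg => e e0.
  have [K0 [rK0 h]] := fc _ (divr_gt0 e0 (ltr0n R 2)); have [J0 fJ0] := fi K0 rK0.
  exists J0; exists K0 => //= K [rK K0K]; have [J fJ] := fi K rK.
  have rD := relatively_compactD rK rK0; have [J' fJ'] := fi _ rD.
  change (rnorm (bochner_integral mu (K : set (borel G)) f - J0) < e).
  rewrite (bochner_integral_rcE rK fJ).
  have DK0 : (K `\` K0) `&` K0 = set0 by apply/seteqP; split=> // t [[]].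
  have UK : (K `\` K0) `|` K0 = K by rewrite setUC setDUK.
  have -> : J = J' + J0.
    apply: (bochner_int_setU (rcm rD) (rcm rK0) (relatively_compact_fin rD)
      (relatively_compact_fin rK0) DK0 _ fJ' fJ0).
    by rewrite UK.
  rewrite addrK (le_lt_trans (h _ _ rD DK0 fJ'))//.
  by rewrite gtr_pMr// invf_lt1// ltr1n.
exists I; apply/uncond_int_cvg; split=> // K rK.
by apply/bochner_integrable_rcP => //; exact: fi.
Qed.

(** Cut K along a K0 off which integrals are at most 1: the part inside K0 is bounded by the
    majorant of |f| on K0, whatever K is. *)
Lemma uncond_int_bounded f I : uncond_int f I -> exists2 M : R, 0 <= M &
  forall K J, relatively_compact (K : set G) -> bochner_int mu K f J -> rnorm J <= M.
Proof.
move=> fI; have [K0 [rK0 h]] := uncond_int_cauchy fI ltr01; have [fi _] := fI.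
have [J0 fJ0] := fi K0 rK0.
have [c c0 dc] := bochner_int_dominated (rcm rK0) (relatively_compact_fin rK0) fJ0.
exists (1 + c) => [|K J rK fJ]; first by rewrite addr_ge0.
have rD := relatively_compactD rK rK0; have [J1 fJ1] := fi _ rD.
have rI : relatively_compact (K `&` K0 : set G).
  apply: (relatively_compactS _ (@subIsetl _ _ _) rK).
  exact: measurableI (rcm rK) (rcm rK0).
have [J2 fJ2] := fi _ rI.
have DI0 : (K `\` K0) `&` (K `&` K0) = set0.
  by apply/seteqP; split=> // t [[_ h1] [_ h2]].
have UK : (K `\` K0) `|` (K `&` K0) = K by rewrite setUC setUIDK.
have -> : J = J1 + J2.
  apply: (bochner_int_setU (rcm rD) (rcm rI) (relatively_compact_fin rD)
    (relatively_compact_fin rI) DI0 _ fJ1 fJ2).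
  by rewrite UK.
rewrite (le_trans (rnormD _ _))// lerD//.
  by apply: h rD _ fJ1; apply/seteqP; split=> // t [[_ h1] h2].
apply: (bochner_int_norm (rcm rI) (relatively_compact_fin rI) fJ2).
apply: dominatedS dc; [exact: rcm rK0|exact: rcm rI|exact: subIsetr].
Qed.

Lemma uncond_int_norm f I M : uncond_int f I ->
  (forall K J, relatively_compact (K : set G) -> bochner_int mu K f J ->
    rnorm J <= M) -> rnorm I <= M.
Proof.
move=> [fi fI] hM; apply/ler_addgt0Pr => e /fI[K0 [rK0 h]].
have [J fJ] := fi K0 rK0; have := h K0 J rK0 (@subset_refl _ _) fJ.
have := hM K0 J rK0 fJ; have := rnorm_triangle I J 0.
by rewrite !subr0 (rnormB I J); lra.
Qed.

Lemma uncond_intD f f' I I' : uncond_int f I -> uncond_int f' I' ->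
  uncond_int (fun t => f t + f' t) (I + I').
Proof.
move=> [fi fI] [fi' fI']; split=> [K rK|e e0].
  have [J fJ] := fi K rK; have [J' fJ'] := fi' K rK.
  by exists (J + J'); exact: (bochner_intD (rcm rK) (relatively_compact_fin rK) fJ fJ').
have e20 : 0 < e / 2 by rewrite divr_gt0.
have [K0 [rK0 h]] := fI _ e20; have [K0' [rK0' h']] := fI' _ e20.
exists (K0 `|` K0'); split=> [|K J rK + fJ].
  exact: relatively_compactU.
rewrite subUset => -[sK0 sK0'].
have [J1 fJ1] := fi K rK; have [J1' fJ1'] := fi' K rK.
have -> : J = J1 + J1'.
  apply: (bochner_int_rc_unique rK fJ).
  exact: (bochner_intD (rcm rK) (relatively_compact_fin rK) fJ1 fJ1').
rewrite opprD addrACA (le_trans (rnormD _ _))// (splitr e) lerD//.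
  exact: h fJ1.
exact: h' fJ1'.
Qed.

Lemma uncond_int_mul f I (phi : G -> R) :
  measurable_fun [set: borel G] (phi : borel G -> R) ->
  (forall t, 0 <= phi t <= 1) -> uncond_int f I ->
  exists J, uncond_int (fun t => (phi t)%:C *: f t) J /\
    forall M, (forall K J, relatively_compact (K : set G) ->
      bochner_int mu K f J -> rnorm J <= M) -> rnorm J <= M.
Proof.
move=> mphi phi01 fI; have [fi _] := fI.
(* Used twice: with K0 empty it gives the bound by M, with K0 from [uncond_int_cauchy] it gives the
   smallness of the tails. *)
have mulK c K0 : (forall K J, relatively_compact (K : set G) ->
      K `&` K0 = set0 -> bochner_int mu K f J -> rnorm J <= c) ->
    forall K, relatively_compact (K : set G) -> K `&` K0 = set0 ->
    exists J, bochner_int mu K (fun t => (phi t)%:C *: f t) J /\ rnorm J <= c.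
  move=> hc K rK KK0.
  apply: (bochner_int_mul (rcm rK) (relatively_compact_fin rK) mphi phi01).
    by apply/bochner_integrable_rcP => //; exact: fi.
  move=> F mF FK; have rF : relatively_compact (F : set G).
    exact: relatively_compactS FK rK.
  have [J fJ] := fi F rF; exists J; split=> //.
  apply: hc rF _ fJ; apply/seteqP; split=> // t [/FK Kt K0t].
  by rewrite -KK0.
have mulM M : (forall K J, relatively_compact (K : set G) ->
      bochner_int mu K f J -> rnorm J <= M) ->
    forall K, relatively_compact (K : set G) ->
    exists J, bochner_int mu K (fun t => (phi t)%:C *: f t) J /\ rnorm J <= M.
  move=> hM K rK; apply: (mulK M set0) => //; last by rewrite setI0.
  by move=> L J rL _; exact: hM.
have [M M0 hM] := uncond_int_bounded fI.
have [||J hJ] := @uncond_int_of_cauchy (fun t => (phi t)%:C *: f t).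
- by move=> K /(mulM M hM)[J [fJ _]]; exists J.
- move=> e /(uncond_int_cauchy fI)[K0 [rK0 h]]; exists K0; split=> // K J rK KK0 fJ.
  by have [J' [fJ' hJ']] := mulK e K0 h K rK KK0; rewrite (bochner_int_rc_unique rK fJ fJ').
exists J; split=> // N hN; apply: (uncond_int_norm hJ) => K J' rK fJ'.
by have [J1 [fJ1 hJ1]] := mulM N hN K rK; rewrite (bochner_int_rc_unique rK fJ' fJ1).
Qed.

End fixed_target.

Lemma uncond_int_brl (V V' : completeNormedModType R[i]) (f : G -> V) (I : V)
    (L : V -> V') : bounded_real_linear L -> uncond_int f I ->
  uncond_int (fun t => L (f t)) (L I).
Proof.
move=> LP [fi fI].
have LK K J : relatively_compact (K : set G) -> bochner_int mu K f J ->
    bochner_int mu K (fun t => L (f t)) (L J).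
  move=> rK; apply: bochner_int_brl => //; first by case: rK.
  exact: relatively_compact_fin.
split=> [K rK|e e0]; first by have [J fJ] := fi K rK; exists (L J); exact: LK.
have [_ _ [C C0 hC]] := LP; have C1 : 0 < C + 1 by rewrite ltr_wpDl.
have [K0 [rK0 h]] := fI _ (divr_gt0 e0 C1); exists K0; split=> // K J rK K0K fJ.
have [J' fJ'] := fi K rK; rewrite (bochner_int_rc_unique rK fJ (LK _ _ rK fJ')).
rewrite -(brlB _ _ LP) (le_trans (hC _))//.
have := h K J' rK K0K fJ'; rewrite ler_pdivlMr// mulrC; apply: le_trans.
by rewrite ler_wpM2r ?rnorm_ge0// lerDl.
Qed.

(** The order of the quantifiers is the point: M comes from f and the fixed coefficients of the
    decomposition, before x is chosen. *)
Lemma uncond_int_pairing (V : completeNormedModType R[i]) (f : G -> V) (I : V) :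
  uncond_int f I -> exists M : R, forall x : dual R G,
    exists J, uncond_int (fun t => x t *: f t) J /\ rnorm J <= M.
Proof.
move=> fI; have [M M0 hM] := uncond_int_bounded fI.
pose c1 := complex.Re `|2 : R[i]|; pose c2 := complex.Re `|2 * 'i%C : R[i]|.
pose c3 := complex.Re `|- (1 + 'i%C) : R[i]|.
have ge0 (z : R[i]) : 0 <= complex.Re `|z|.
  by rewrite -ler0c RRe_real// ger0_real.
have half (h : G -> R) : continuous h -> (forall t, `|h t| <= 1) ->
    exists J, uncond_int (fun t => ((1 + h t) / 2)%:C *: f t) J /\ rnorm J <= M.
  move=> ch h1; have [||J [fJ hJ]] := @uncond_int_mul V f I (fun t => (1 + h t) / 2) _ _ fI.
  - apply: continuous_borel_measurable => t; apply: cvgMl; apply: cvgD.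
      exact: cvg_cst.
    exact: ch.
  - by move=> t; have := h1 t; rewrite ler_norml => /andP[? ?]; apply/andP; split; lra.
  by exists J; split=> //; exact: hJ.
exists (c1 * M + (c2 * M + c3 * M)) => x.
have x1 t : complex.Re `|x t| = 1 by rewrite pairing_norm.
have [|J1 [fJ1 hJ1]] := half _ (@pairing_Re_continuous R G x).
  by move=> t; rewrite -(x1 t); exact: Re_norm_le.
have [|J2 [fJ2 hJ2]] := half _ (@pairing_Im_continuous R G x).
  by move=> t; rewrite -(x1 t); exact: Im_norm_le.
exists (2 *: J1 + ((2 * 'i%C) *: J2 + (- (1 + 'i%C)) *: I)); split.
  apply: (uncond_int_ext (fun t => esym (complex_unit_decomposition (x t) (f t)))).
  apply: uncond_intD; first exact: uncond_int_brl (brl_scale _ _) fJ1.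
  by apply: uncond_intD; apply: uncond_int_brl => //; exact: brl_scale.
have hI : rnorm I <= M by exact: uncond_int_norm fI hM.
rewrite (le_trans (rnormD _ _))// rnormZ lerD// ?ler_wpM2l//.
by rewrite (le_trans (rnormD _ _))// !rnormZ lerD// ler_wpM2l.
Qed.

Lemma haar_translation (s : G) (B : set (borel G)) : measurable B ->
  mu [set t | B (s + t : G)] = mu B.
Proof.
move=> mB; have [_ _ _ _ tinv] := mu_haar.
rewrite -(tinv (- s) B mB); congr (mu _); apply/seteqP; split=> [t Bt|_ [t Bt <-] /=].
  by exists (s + t) => //; rewrite addKr.
by rewrite addNKr.
Qed.

(** Approximations and majorants are translated along with f. The measures of the fibres do not
    change, and the integral of the majorant is handled by the equality of [mu] with its
    push-forward under translation. *)
Lemma bochner_int_translation (V : completeNormedModType R[i]) (s : G)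
    (K : set (borel G)) (f : G -> V) (J : V) : measurable K ->
  bochner_int mu K f J ->
  bochner_int mu [set t | K (s + t : G)] (fun t => f (s + t)) J.
Proof.
move=> mK fJ e /fJ[p [[[fp mp] [g [mg g0 fg ig]]] hJ]].
pose sh (t : borel G) : borel G := (s + t : G).
have msh : measurable_fun setT sh := @translation_measurable G s.
have mpre (B : set (borel G)) : measurable B -> measurable (sh @^-1` B).
  by move=> mB; rewrite -[X in measurable X]setTI; exact: msh.
have sp : is_simple (fun t => p (sh t)).
  split=> [|v]; last exact: (mpre _ (mp v)).
  by apply: (sub_finite_set _ fp) => _ [t _ <-]; exists (sh t).
exists (fun t => p (sh t)); split; last first.
  suff -> : simple_integral mu (sh @^-1` K) (fun t => p (sh t)) =
      simple_integral mu K p by [].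
  rewrite /simple_integral.
  have -> : range (fun t => p (sh t)) = range p.
    apply/seteqP; split=> _ [t _ <-]; first by exists (sh t).
    by exists (- s + t : G) => //=; rewrite /sh addNKr.
  apply: eq_fsbigr => v _; congr ((fine _)%:C *: v).
  exact: (haar_translation s (measurableI _ _ mK (mp v))).
split=> //; exists (fun t => g (sh t)); split.
- move=> mshK Y mY; rewrite (_ : _ `&` _ = sh @^-1` (K `&` g @^-1` Y))//.
  by apply: mpre; exact: mg.
- by move=> t; exact: g0.
- by move=> t; exact: fg.
- apply: le_trans ig; rewrite -(@ge0_integral_pushforward _ _ _ _ _ _ msh mu K g mK mg).
    rewrite (@eq_measure_integral _ _ _ _ mu)// => B mB _.
    exact: (haar_translation s mB).
  by move=> t /set_mem; exact: g0.
Qed.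

Lemma uncond_int_translation (V : completeNormedModType R[i]) (s : G)
    (f : G -> V) (I : V) : uncond_int f I -> uncond_int (fun t => f (s + t)) I.
Proof.
move=> [fi fI].
have hK K : relatively_compact (K : set G) -> exists J,
    bochner_int mu [set t | K (- s + t)] f J /\
    bochner_int mu (K : set (borel G)) (fun t => f (s + t)) J.
  move=> rK; have rK' := relatively_compact_translate (- s) G_hausdorff rK.
  have [J fJ] := fi _ rK'; exists J; split=> //.
  have := bochner_int_translation s (proj1 rK') fJ; congr bochner_int.
  by apply/seteqP; split=> t /=; rewrite addKr.
split=> [K /hK[J [_ fJ]]|e /fI[K0 [rK0 h]]]; first by exists J.
exists [set t | K0 (s + t)]; split.
  exact: relatively_compact_translate.
move=> K J rK K0K fJ; have [J' [fJ' fJ2]] := hK K rK.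
rewrite (bochner_int_rc_unique rK fJ fJ2).
apply: h fJ'; first exact: relatively_compact_translate.
by move=> t K0t /=; apply: K0K; rewrite /= addNKr.
Qed.

End unconditional_integral_theory.

(** * Multipliers and Fourier coefficients *)

Section multiplier_theory.
Context {R : realType} {A : cstarAlgType R}.
Implicit Types (a b c : A) (m n p q : multiplier A).
Local Open Scope complex_scope.

Lemma cmul_injr a b : (forall c, c ** a = c ** b) -> a = b.
Proof.
move=> h; apply/eqP; rewrite -subr_eq0; apply/eqP; apply: cmul_right_eq0 => c.
by rewrite cmulBr h subrr.
Qed.

Lemma cmul_injl a b : (forall c, a ** c = b ** c) -> a = b.
Proof.
move=> h; apply/eqP; rewrite -subr_eq0; apply/eqP; apply: cmul_left_eq0 => c.
by rewrite cmulBl h subrr.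
Qed.

Lemma brl_cmulr b : bounded_real_linear (fun a => a ** b).
Proof.
split=> [u v|r v|]; [exact: cmulDl|exact: cmulZl|].
by exists (rnorm b) => [|v]; rewrite ?rnorm_ge0// mulrC rnorm_cmul.
Qed.

Lemma brl_cmull b : bounded_real_linear (fun a => b ** a).
Proof.
split=> [u v|r v|]; [exact: cmulDr|exact: cmulZr|].
by exists (rnorm b) => [|v]; rewrite ?rnorm_ge0// rnorm_cmul.
Qed.

Lemma brl_star : bounded_real_linear (@star R A).
Proof.
split=> [u v|r v|]; first exact: starD.
  by rewrite starZ; congr (_ *: _); exact: conjc_real.
by exists 1 => // v; rewrite rnorm_star mul1r.
Qed.

(** [multiplierP] moves m onto the test factor c, where the product of A is already bilinear and
    associative, and [cmul_injr] cancels c. The five lemmas below work in the same way. *)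
Lemma lmulmD m : {morph lmulm m : a b / a + b}.
Proof. by move=> a b; apply: cmul_injr => c; rewrite cmulDr !multiplierP cmulDr. Qed.

Lemma lmulmZ m (k : R[i]) a : lmulm m (k *: a) = k *: lmulm m a.
Proof. by apply: cmul_injr => c; rewrite cmulZr !multiplierP cmulZr. Qed.

Lemma lmulmM m a b : lmulm m (a ** b) = lmulm m a ** b.
Proof. by apply: cmul_injr => c; rewrite multiplierP !cmulA multiplierP. Qed.

Lemma rmulmD m : {morph rmulm m : a b / a + b}.
Proof. by move=> a b; apply: cmul_injl => c; rewrite cmulDl -!multiplierP cmulDl. Qed.

Lemma rmulmZ m (k : R[i]) a : rmulm m (k *: a) = k *: rmulm m a.
Proof. by apply: cmul_injl => c; rewrite cmulZl -!multiplierP cmulZl. Qed.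

Lemma rmulmM m a b : rmulm m (a ** b) = a ** rmulm m b.
Proof. by apply: cmul_injl => c; rewrite -multiplierP -!cmulA multiplierP. Qed.

Definition multiplier_bound m (C : R) :=
  forall b, rnorm (lmulm m b) <= C * rnorm b.

(* The maps [b |-> c (m b) = (c m) b], [|c| <= 1], are bounded, and pointwise
   bounded by [|m b|]. *)
Lemma multiplier_bounded m : exists2 C : R, 0 <= C & multiplier_bound m C.
Proof.
have [||C C0 hC] := @uniform_boundedness R A A {c : A | rnorm c <= 1}
    (fun (c : {c : A | rnorm c <= 1}) (b : A) => sval c ** lmulm m b).
- move=> [c c1]; split=> [u v|r v|]; rewrite /= ?lmulmD ?cmulDr ?lmulmZ ?cmulZr//.
  exists (rnorm (rmulm m c)) => [|v]; first exact: rnorm_ge0.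
  by rewrite multiplierP rnorm_cmul.
- move=> b; exists (rnorm (lmulm m b)) => -[c c1] /=.
  by rewrite (le_trans (rnorm_cmul _ _))// ler_piMl ?rnorm_ge0.
exists C => // b; set y := lmulm m b.
have [->|y0] := eqVneq y 0; first by rewrite rnorm0 mulr_ge0 ?rnorm_ge0.
have y_gt0 : 0 < rnorm y by rewrite lt_neqAle eq_sym rnorm_eq0 y0 rnorm_ge0.
have c1 : rnorm ((rnorm y)^-1%:C *: star y) <= 1.
  by rewrite rnormZr rnorm_star gtr0_norm ?invr_gt0// mulVf// gt_eqF.
have := hC (exist (fun c : A => is_true (rnorm c <= 1)) _ c1) b.
rewrite /= cmulZl rnormZr rnorm_cstar gtr0_norm ?invr_gt0// expr2 mulrA mulVf ?gt_eqF//.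
by rewrite mul1r.
Qed.

Lemma multiplier_bound_r m C a : 0 <= C -> multiplier_bound m C ->
  rnorm (rmulm m a) <= C * rnorm a.
Proof.
move=> C0 hC; set y := rmulm m a.
have [->|y0] := eqVneq y 0; first by rewrite rnorm0 mulr_ge0 ?rnorm_ge0.
have y_gt0 : 0 < rnorm y by rewrite lt_neqAle eq_sym rnorm_eq0 y0 rnorm_ge0.
rewrite -(ler_pM2r y_gt0) -expr2 -rnorm_cstar_r -multiplierP.
rewrite (le_trans (rnorm_cmul _ _))// (mulrC C) -mulrA ler_wpM2l ?rnorm_ge0//.
by rewrite -(rnorm_star y) hC.
Qed.

Lemma brl_lmulm m : bounded_real_linear (lmulm m).
Proof.
have [C C0 hC] := multiplier_bounded m.
by split=> [u v|r v|]; [exact: lmulmD|exact: lmulmZ|exists C].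
Qed.

Lemma brl_rmulm m : bounded_real_linear (rmulm m).
Proof.
have [C C0 hC] := multiplier_bounded m.
split=> [u v|r v|]; [exact: rmulmD|exact: rmulmZ|exists C => // v].
exact: multiplier_bound_r.
Qed.

Lemma mnorm_leP m (C : R) : 0 <= C ->
  (mnorm m <= C%:E)%E <-> multiplier_bound m C.
Proof.
move=> C0; split=> [hC b|hC].
  have [->|b0] := eqVneq b 0; first by rewrite (brl0 (brl_lmulm m)) !rnorm0 mulr0.
  have b_gt0 : 0 < rnorm b by rewrite lt_neqAle eq_sym rnorm_eq0 b0 rnorm_ge0.
  rewrite -ler_pdivrMr// mulrC -[leLHS]ger0_norm ?mulr_ge0 ?invr_ge0 ?rnorm_ge0//.
  rewrite normrM (ger0_norm (rnorm_ge0 _)) -rnormZr -lmulmZ -lee_fin.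
  apply: le_trans hC; apply: ereal_sup_ubound.
  exists ((rnorm b)^-1%:C *: b) => //=.
  by rewrite rnormE rnormZr gtr0_norm ?invr_gt0// mulVf ?gt_eqF.
apply: ge_ereal_sup => _ [b /= b1 <-]; rewrite lee_fin (le_trans (hC b))//.
by rewrite ler_piMr// -lecR -rnormE.
Qed.

Fact mstar_subproof m a b :
  a ** star (rmulm m (star b)) = star (lmulm m (star a)) ** b.
Proof. by rewrite -{1}(starK a) -starM -{2}(starK b) -starM multiplierP. Qed.

(** The adjoint in M(A), forced by m^* b = (b^* m)^*. *)
Definition mstar m := Multiplier (mstar_subproof m).

Lemma rnorm_mstar_commutator m1 m2 n1 n2 a :
  rnorm (lmulm (mmul (mstar m1) (mstar m2) - mmul (mstar n1) (mstar n2)) a) =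
  rnorm (rmulm (mmul m2 m1 - mmul n2 n1) (star a)).
Proof. by rewrite /= !starK -starB rnorm_star. Qed.

(** The term p' n q is inserted between p m q and p' m q'. In the use below m is E_w(c) and n is
    E_(z+w)(c). *)
Lemma lmulm_middle p p' m n q q' a :
  lmulm p (lmulm m (lmulm q a)) - lmulm p' (lmulm m (lmulm q' a)) =
  lmulm (mmul p m - mmul p' n) (lmulm q a) +
  lmulm p' (lmulm (mmul n q - mmul m q') a).
Proof. by rewrite /= (brlB _ _ (brl_lmulm p')) addrA subrK. Qed.

End multiplier_theory.

(** * Fourier coefficients *)

Section fourier.
Context {R : realType} {A : cstarAlgType R} {G : topologicalZmodType}.
Context (alpha : cstar_action A G) {mu : {measure set (borel G) -> \bar R}}.
Hypotheses (G_hausdorff : hausdorff_space G) (mu_haar : haar_measure mu).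
Local Open Scope complex_scope.
Implicit Types (a b c : A) (x y z w : dual R G) (m : multiplier A).

Let uint (f : G -> A) (I : A) := @uncond_int R G mu A f I.
Let E := fourier_coefficient alpha mu.

Lemma uncond_int_unique (f : G -> A) (I J : A) : uint f I -> uint f J -> I = J.
Proof.
by move=> fI fJ; rewrite -(unconditional_integralE mu_haar fI)
  (unconditional_integralE mu_haar fJ).
Qed.

Lemma uncond_int_eq (f g : G -> A) (I J : A) :
  uint f I -> uint g J -> f =1 g -> I = J.
Proof. by move=> fI gJ /funext fg; subst g; exact: uncond_int_unique fI gJ. Qed.

Lemma brl_action t : bounded_real_linear (alpha t).
Proof.
have sa := action_star_automorphism alpha t; have [_ lin _ _] := sa.
have aD : {morph alpha t : a b / a + b}.
  by move=> a b; have := lin 1 a b; rewrite !scale1r.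
have a0 : alpha t 0 = 0 by apply: (addrI (alpha t 0)); rewrite -aD !addr0.
split=> // [r a|]; first by have := lin r%:C a 0; rewrite a0 !addr0.
by exists 1 => // a; rewrite mul1r star_automorphism_norm.
Qed.

Lemma actionZ t (k : R[i]) a : alpha t (k *: a) = k *: alpha t a.
Proof.
have [_ lin _ _] := action_star_automorphism alpha t.
by have := lin k a 0; rewrite (brl0 (brl_action t)) !addr0.
Qed.

Lemma action_star t a : alpha t (star a) = star (alpha t a).
Proof. by case: (action_star_automorphism alpha t). Qed.

Lemma actionK t : cancel (alpha t) (alpha (- t)).
Proof. by move=> a; rewrite -actionD addNr action0. Qed.

Lemma alpha_integrableP a : alpha_integrable alpha mu a <-> forall b,
  (exists I, uint (fun t => alpha t a ** b) I) /\
  (exists I, uint (fun t => b ** alpha t a) I).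
Proof.
split=> h b; have [h1 h2] := h b.
  by split; apply/(unconditionally_integrableP mu_haar).
by split; apply/(unconditionally_integrableP mu_haar).
Qed.

(** Unlike [is_fourier_coefficient], this asserts that the integrals exist; at x = 0 it therefore
    contains integrability, see [fourier_spec_integrable]. *)
Definition fourier_spec x a m := forall b,
  uint (fun t => x t *: (alpha t a ** b)) (lmulm m b) /\
  uint (fun t => x t *: (b ** alpha t a)) (rmulm m b).

Lemma fourier_spec_unique x a m n : fourier_spec x a m -> fourier_spec x a n -> m = n.
Proof.
move=> hm hn; apply: multiplier_eqP => b; have [m1 m2] := hm b; have [n1 n2] := hn b.
  exact: uncond_int_unique m1 n1.
exact: uncond_int_unique m2 n2.
Qed.

(** Left and right integrals are chosen separately for each b. They form a double centralizer
    because multiplication by b on the left and by c on the right commutes with the integral. *)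
Lemma fourier_spec_ex x a : alpha_integrable alpha mu a -> exists m, fourier_spec x a m.
Proof.
move=> /alpha_integrableP ia.
have pint (f : G -> A) : (exists I, uint f I) -> exists I, uint (fun t => x t *: f t) I.
  move=> [I /(uncond_int_pairing mu_haar)[M /(_ x)[J [fJ _]]]].
  by exists J.
have /choice[l hl] b : exists I, uint (fun t => x t *: (alpha t a ** b)) I.
  by apply: pint; case: (ia b).
have /choice[r hr] b : exists I, uint (fun t => x t *: (b ** alpha t a)) I.
  by apply: pint; case: (ia b).
have lrP b c : b ** l c = r b ** c.
  apply: (uncond_int_eq (uncond_int_brl mu_haar (brl_cmull b) (hl c))
    (uncond_int_brl mu_haar (brl_cmulr c) (hr b))) => t.
  by rewrite cmulZr cmulZl cmulA.
by exists (Multiplier lrP) => b.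
Qed.

Lemma fourier_coefficientP x a : alpha_integrable alpha mu a -> fourier_spec x a (E x a).
Proof.
move=> /(fourier_spec_ex x)[m hm].
suff <- : m = E x a by [].
have hE : is_fourier_coefficient alpha mu x a (E x a).
  apply: xgetPex; exists m => b; have [h1 h2] := hm b.
  by rewrite (unconditional_integralE mu_haar h1) (unconditional_integralE mu_haar h2).
apply: multiplier_eqP => b; have [h1 h2] := hm b; have [e1 e2] := hE b.
  by rewrite e1 (unconditional_integralE mu_haar h1).
by rewrite e2 (unconditional_integralE mu_haar h2).
Qed.

Lemma fourier_coefficientE x a m : alpha_integrable alpha mu a ->
  fourier_spec x a m -> E x a = m.
Proof. by move=> ia; exact/fourier_spec_unique/fourier_coefficientP. Qed.

Lemma pairing_opp w t : (- w : dual R G) t = ((w t)^*)%R.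
Proof.
rewrite /= invC_norm pairing_norm expr1n invr1 mul1r.
by [].
Qed.

Lemma pairing_opp_mul w t : (- w : dual R G) t * w t = 1.
Proof. by rewrite /= mulVf// pairing_neq0. Qed.

Lemma alpha_integrableD a b : alpha_integrable alpha mu a ->
  alpha_integrable alpha mu b -> alpha_integrable alpha mu (a + b).
Proof.
move=> /alpha_integrableP ia /alpha_integrableP ib; apply/alpha_integrableP => c.
have [[I1 h1] [I2 h2]] := ia c; have [[J1 k1] [J2 k2]] := ib c.
have aD t : alpha t (a + b) = alpha t a + alpha t b by case: (brl_action t) => ->.
split; [exists (I1 + J1)|exists (I2 + J2)].
  by apply: uncond_int_ext (uncond_intD mu_haar h1 k1) => t; rewrite aD cmulDl.
by apply: uncond_int_ext (uncond_intD mu_haar h2 k2) => t; rewrite aD cmulDr.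
Qed.

Lemma fourier_coefficientD x a b : alpha_integrable alpha mu a ->
  alpha_integrable alpha mu b -> E x (a + b) = E x a + E x b.
Proof.
move=> ia ib; apply: fourier_coefficientE; first exact: alpha_integrableD.
move=> c; have [h1 h2] := fourier_coefficientP x ia c.
have [k1 k2] := fourier_coefficientP x ib c.
have aD t : alpha t (a + b) = alpha t a + alpha t b by case: (brl_action t) => ->.
split.
  by apply: uncond_int_ext (uncond_intD mu_haar h1 k1) => t; rewrite aD cmulDl scalerDr.
by apply: uncond_int_ext (uncond_intD mu_haar h2 k2) => t; rewrite aD cmulDr scalerDr.
Qed.

Lemma alpha_integrable_star a : alpha_integrable alpha mu a ->
  alpha_integrable alpha mu (star a).
Proof.
move=> /alpha_integrableP ia; apply/alpha_integrableP => c.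
have [[I1 h1] [I2 h2]] := ia (star c).
split; [exists (star I2)|exists (star I1)].
  apply: uncond_int_ext (uncond_int_brl mu_haar brl_star h2) => t.
  by rewrite starM starK action_star.
apply: uncond_int_ext (uncond_int_brl mu_haar brl_star h1) => t.
by rewrite starM starK action_star.
Qed.

Lemma fourier_coefficient_star x a : alpha_integrable alpha mu a ->
  E x (star a) = mstar (E (- x) a).
Proof.
move=> ia; apply: fourier_coefficientE; first exact: alpha_integrable_star.
move=> c; have [h1 h2] := fourier_coefficientP (- x) ia (star c); split.
  apply: uncond_int_ext (uncond_int_brl mu_haar brl_star h2) => t.
  by rewrite starZ pairing_opp conjCK starM starK action_star.
apply: uncond_int_ext (uncond_int_brl mu_haar brl_star h1) => t.
by rewrite starZ pairing_opp conjCK starM starK action_star.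
Qed.

(** * Products with spectral multipliers *)

Section spectral.
Variables (w : dual R G) (m : multiplier A).
Hypothesis wm : spectral_multipliers alpha w m.

Lemma action_lmulm t a : alpha t (lmulm m a) = (- w : dual R G) t *: lmulm m (alpha t a).
Proof.
rewrite pairing_opp; have /(congr1 (fun n => lmulm n (alpha t a))) := wm t.
by rewrite /= actionK.
Qed.

Lemma action_rmulm t a : alpha t (rmulm m a) = (- w : dual R G) t *: rmulm m (alpha t a).
Proof.
rewrite pairing_opp; have /(congr1 (fun n => rmulm n (alpha t a))) := wm t.
by rewrite /= actionK.
Qed.

(** The action turns m a into conj(w(t)) m alpha_t(a), and the scalar shifts x to x - w. For the
    left integral m is pulled out as a bounded map; for the right one it is absorbed into the test
    element, b becoming b m. *)
Lemma spectral_lmulm a : alpha_integrable alpha mu a ->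
  forall x, fourier_spec x (lmulm m a) (mmul m (E (x - w) a)).
Proof.
move=> ia x b; split.
  have [h _] := fourier_coefficientP (x - w) ia b.
  apply: uncond_int_ext (uncond_int_brl mu_haar (brl_lmulm m) h) => t.
  by rewrite action_lmulm lmulmZ lmulmM cmulZl scalerA.
have [_ h] := fourier_coefficientP (x - w) ia (rmulm m b).
apply: uncond_int_ext h => t.
by rewrite action_lmulm cmulZr scalerA multiplierP.
Qed.

Lemma spectral_rmulm a : alpha_integrable alpha mu a ->
  forall x, fourier_spec x (rmulm m a) (mmul (E (x - w) a) m).
Proof.
move=> ia x b; split.
  have [h _] := fourier_coefficientP (x - w) ia (lmulm m b).
  apply: uncond_int_ext h => t.
  by rewrite action_rmulm cmulZl scalerA multiplierP.
have [_ h] := fourier_coefficientP (x - w) ia b.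
apply: uncond_int_ext (uncond_int_brl mu_haar (brl_rmulm m) h) => t.
by rewrite action_rmulm rmulmZ rmulmM cmulZr scalerA.
Qed.

Lemma fourier_spec_integrable a n : fourier_spec 0 a n -> alpha_integrable alpha mu a.
Proof.
move=> h; apply/alpha_integrableP => b; have [h1 h2] := h b.
split; [exists (lmulm n b); apply: uncond_int_ext h1|
        exists (rmulm n b); apply: uncond_int_ext h2] => t.
  exact: scale1r.
exact: scale1r.
Qed.

Lemma alpha_integrable_lmulm a : alpha_integrable alpha mu a ->
  alpha_integrable alpha mu (lmulm m a).
Proof. by move=> ia; exact: fourier_spec_integrable (spectral_lmulm ia 0). Qed.

Lemma alpha_integrable_rmulm a : alpha_integrable alpha mu a ->
  alpha_integrable alpha mu (rmulm m a).
Proof. by move=> ia; exact: fourier_spec_integrable (spectral_rmulm ia 0). Qed.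

Lemma fourier_coefficient_lmulm x a : alpha_integrable alpha mu a ->
  E x (lmulm m a) = mmul m (E (x - w) a).
Proof.
move=> ia; apply: fourier_coefficientE; first exact: alpha_integrable_lmulm.
exact: spectral_lmulm.
Qed.

Lemma fourier_coefficient_rmulm x a : alpha_integrable alpha mu a ->
  E x (rmulm m a) = mmul (E (x - w) a) m.
Proof.
move=> ia; apply: fourier_coefficientE; first exact: alpha_integrable_rmulm.
exact: spectral_rmulm.
Qed.

End spectral.

(** Applying alpha_t inside the integral gives the integrand w(s) alpha_(t+s)(c) b, which is
    conj(w(t)) times w(t+s) alpha_(t+s)(c) b, a translate of the integrand of E_w(c) b. *)
Lemma fourier_coefficient_spectral w c : alpha_integrable alpha mu c ->
  spectral_multipliers alpha w (E w c).
Proof.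
move=> ic t; have hw := fourier_coefficientP w ic.
have wE s : w s = ((w t)^*)%R * w (t + s).
  by rewrite pairingD mulrA -pairing_opp pairing_opp_mul mul1r.
apply: multiplier_eqP => b /=.
  have [h1 _] := hw (alpha (- t) b); have [h2 _] := hw b.
  apply: (uncond_int_eq (uncond_int_brl mu_haar (brl_action t) h1)
    (uncond_int_brl mu_haar (brl_scale _ ((w t)^*)%R)
      (uncond_int_translation G_hausdorff mu_haar t h2))) => s.
  by rewrite actionZ action_mul actionNK -actionD scalerA -wE.
have [_ h1] := hw (alpha (- t) b); have [_ h2] := hw b.
apply: (uncond_int_eq (uncond_int_brl mu_haar (brl_action t) h1)
  (uncond_int_brl mu_haar (brl_scale _ ((w t)^*)%R)
    (uncond_int_translation G_hausdorff mu_haar t h2))) => s.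
by rewrite actionZ action_mul actionNK -actionD scalerA -wE.
Qed.

Lemma fourier_coefficient_bounded a : alpha_integrable alpha mu a ->
  exists2 C : R, 0 <= C & forall x, multiplier_bound (E x a) C.
Proof.
move=> ia; apply: (@uniform_boundedness R A A (dual R G) (fun x => lmulm (E x a))).
  by move=> x; exact: brl_lmulm.
move=> b; have /alpha_integrableP/(_ b)[[I h] _] := ia.
have [M hM] := uncond_int_pairing mu_haar h; exists M => x.
have [J [hJ JM]] := hM x; have [h1 _] := fourier_coefficientP x ia b.
by rewrite (uncond_int_unique h1 hJ).
Qed.

(** * Relative continuity *)

Definition rc_defect z x y a b :=
  mmul (E (x + z) a) (E y b) - mmul (E x a) (E (z + y) b).

Lemma relatively_continuousP a b : relatively_continuous alpha mu a b <->
  [/\ alpha_integrable alpha mu a, alpha_integrable alpha mu b &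
    forall eps : R, 0 < eps -> \forall z \near (0 : dual R G), forall x y,
      multiplier_bound (rc_defect z x y a b) eps].
Proof.
split=> -[ia ib h]; (split; [exact: ia|exact: ib|]) => eps e0;
  move: (h eps e0); apply: filterS => z hz x y.
  by apply/(mnorm_leP _ (ltW e0)); exact: hz.
by apply/(mnorm_leP _ (ltW e0)); exact: hz.
Qed.

Lemma relatively_continuousD a b c : relatively_continuous alpha mu a c ->
  relatively_continuous alpha mu b c -> relatively_continuous alpha mu (a + b) c.
Proof.
move=> /relatively_continuousP[ia ic hac] /relatively_continuousP[ib _ hbc].
apply/relatively_continuousP; split; [exact: alpha_integrableD ia ib|exact: ic|].
move=> eps e0; have e20 : 0 < eps / 2 by rewrite divr_gt0.
apply: filterS2 (hac _ e20) (hbc _ e20) => z ha hb x y v.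
rewrite /rc_defect !(fourier_coefficientD _ ia ib) /= opprD addrACA.
rewrite (le_trans (rnormD _ _))// (splitr eps) mulrDl.
by rewrite lerD//; [exact: ha|exact: hb].
Qed.

(** The defect of b^* and a^* at (x, y) is the adjoint of the defect of a and b at (-(z + y), -(x +
    z)), with the same z. The adjoint exchanges left and right actions, whence
    [multiplier_bound_r]. *)
Lemma relatively_continuous_star a b : relatively_continuous alpha mu a b ->
  relatively_continuous alpha mu (star b) (star a).
Proof.
move=> /relatively_continuousP[ia ib h].
apply/relatively_continuousP; split.
- exact: alpha_integrable_star ib.
- exact: alpha_integrable_star ia.
- move=> eps e0; move: (h eps e0); apply: filterS => z hz x y v.
  have e : rc_defect z (- (z + y)) (- (x + z)) a b =
      mmul (E (- y) a) (E (- (x + z)) b) - mmul (E (- (z + y)) a) (E (- x) b).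
    have e1 : - (z + y) + z = - y by rewrite opprD addrAC addNr add0r.
    have e2 : z - (x + z) = - x by rewrite opprD addrCA subrr addr0.
    exact: (congr2 (fun u t => mmul (E u a) (E (- (x + z)) b) -
      mmul (E (- (z + y)) a) (E t b)) e1 e2).
  have := multiplier_bound_r (star v) (ltW e0) (hz (- (z + y)) (- (x + z))).
  rewrite e rnorm_star => hv.
  rewrite /rc_defect !(fourier_coefficient_star _ ia) !(fourier_coefficient_star _ ib).
  by rewrite rnorm_mstar_commutator.
Qed.

(** The factor m comes out of the defect at the outer end and costs a bound of m; the shift of x or
    y by w is harmless by uniformity. *)
Lemma relatively_continuous_spectral a b w m : relatively_continuous alpha mu a b ->
  spectral_multipliers alpha w m ->
  relatively_continuous alpha mu (lmulm m a) b /\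
  relatively_continuous alpha mu a (rmulm m b).
Proof.
move=> /relatively_continuousP[ia ib h] wm.
have [C C0 hC] := multiplier_bounded m; have C1 : 0 < C + 1 by rewrite ltr_wpDl.
have near_e eps : 0 < eps -> \forall z \near (0 : dual R G), forall x y,
    multiplier_bound (rc_defect z x y a b) (eps / (C + 1)).
  by move=> e0; apply: h; rewrite divr_gt0.
have hCe (eps r : R) : 0 < eps -> 0 <= r -> C * (eps / (C + 1) * r) <= eps * r.
  move=> e0 r0; rewrite mulrA ler_wpM2r// mulrCA ler_piMr ?(ltW e0)//.
  by rewrite ler_pdivrMr// mul1r lerDl.
split; apply/relatively_continuousP; split.
- exact: alpha_integrable_lmulm wm _ ia.
- exact: ib.
- move=> eps e0; apply: filterS (near_e _ e0) => z hz x y v.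
  rewrite /rc_defect !(fourier_coefficient_lmulm wm _ ia) /= -(brlB _ _ (brl_lmulm m)).
  rewrite (le_trans (hC _))// (le_trans _ (hCe _ _ e0 (rnorm_ge0 v)))//.
  by rewrite ler_wpM2l//; have := hz (x - w) y v; rewrite /rc_defect /= addrAC.
- exact: ia.
- exact: alpha_integrable_rmulm wm _ ib.
- move=> eps e0; apply: filterS (near_e _ e0) => z hz x y v.
  rewrite /rc_defect !(fourier_coefficient_rmulm wm _ ib) /= -addrA.
  rewrite (le_trans (hz x (y - w) (lmulm m v)))//.
  rewrite (le_trans _ (hCe _ _ e0 (rnorm_ge0 v)))// mulrCA.
  by rewrite ler_wpM2l ?divr_ge0 ?(ltW e0) ?(ltW C1).
Qed.

(* [E_{x+z}(a) E_w(c) E_y(b) - E_x(a) E_w(c) E_{z+y}(b)] is the sum of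
   [(E_{x+z}(a) E_w(c) - E_x(a) E_{z+w}(c)) E_y(b)] and
   [E_x(a) (E_{w+z}(c) E_y(b) - E_w(c) E_{z+y}(b))]. *)
Lemma relatively_continuous_middle a b c w : relatively_continuous alpha mu a c ->
  relatively_continuous alpha mu c b -> forall eps : R, 0 < eps ->
  \forall z \near (0 : dual R G), forall x y v,
    rnorm (lmulm (E (x + z) a) (lmulm (E w c) (lmulm (E y b) v)) -
           lmulm (E x a) (lmulm (E w c) (lmulm (E (z + y) b) v))) <= eps * rnorm v.
Proof.
move=> /relatively_continuousP[ia ic hac] /relatively_continuousP[_ ib hcb] eps e0.
have [Ca Ca0 hCa] := fourier_coefficient_bounded ia.
have [Cb Cb0 hCb] := fourier_coefficient_bounded ib.
have C1 : 0 < Ca + Cb + 1 by rewrite ltr_wpDl// addr_ge0.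
have d0 : 0 < eps / (Ca + Cb + 1) by rewrite divr_gt0.
apply: filterS2 (hac _ d0) (hcb _ d0) => z ha hb x y v.
have h1 := ha x w (lmulm (E y b) v).
have h2 := hCa x (lmulm (rc_defect z w y c b) v).
have h3 := hb w y v; have h4 := hCb y v.
set d := eps / _ in d0 h1 h3.
have {}h1 := le_trans h1 (ler_wpM2l (ltW d0) h4).
have {}h2 := le_trans h2 (ler_wpM2l Ca0 h3).
have -> : eps = d * (Ca + Cb + 1) by rewrite /d divfK// gt_eqF.
have e : rc_defect z w y c b =
    mmul (E (z + w) c) (E y b) - mmul (E w c) (E (z + y) b).
  exact: (congr1 (fun u => mmul (E u c) (E y b) - mmul (E w c) (E (z + y) b))
    (addrC w z)).
rewrite e in h2; rewrite (lmulm_middle _ _ _ (E (z + w) c)).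
apply: le_trans (rnormD _ _) _; apply: le_trans (lerD h1 h2) _.
by have := mulr_ge0 (ltW d0) (rnorm_ge0 v); lra.
Qed.

(** Since E_w(c) is a spectral multiplier, both conclusions lead to the same triple products with
    E_w(c) in the middle, up to a shift of x or of y by w. *)
Lemma relatively_continuous_fourier a b c w : relatively_continuous alpha mu a c ->
  relatively_continuous alpha mu c b ->
  relatively_continuous alpha mu (rmulm (E w c) a) b /\
  relatively_continuous alpha mu a (lmulm (E w c) b).
Proof.
move=> hac hcb; have mid := relatively_continuous_middle w hac hcb.
have /relatively_continuousP[ia ic _] := hac.
have /relatively_continuousP[_ ib _] := hcb.
have wE := fourier_coefficient_spectral w ic.
split; apply/relatively_continuousP; split.
- exact: alpha_integrable_rmulm wE _ ia.
- exact: ib.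
- move=> eps /mid; apply: filterS => z hz x y v.
  by rewrite /rc_defect !(fourier_coefficient_rmulm wE _ ia) /= addrAC; exact: hz.
- exact: ia.
- exact: alpha_integrable_lmulm wE _ ib.
- move=> eps /mid; apply: filterS => z hz x y v.
  by rewrite /rc_defect !(fourier_coefficient_lmulm wE _ ib) /= -addrA; exact: hz.
Qed.

End fourier.

Theorem proposition8p3 (R : realType) (A : cstarAlgType R)
    (G : topologicalZmodType)
    (G_hausdorff : hausdorff_space G)
    (G_locally_compact : locally_compact [set: G])
    (mu : {measure set (borel G) -> \bar R})
    (mu_haar : haar_measure mu)
    (alpha : cstar_action A G)
    (a b c : A)
    (a_integrable : alpha_integrable alpha mu a)
    (b_integrable : alpha_integrable alpha mu b)
    (c_integrable : alpha_integrable alpha mu c) :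
  let E := fourier_coefficient alpha mu in
  let rc := relatively_continuous alpha mu in
  [/\ rc a c -> rc b c -> rc (a + b) c,
      rc a b -> rc (star b) (star a),
      rc a b -> forall (w : dual R G) (m : multiplier A),
        spectral_multipliers alpha w m -> rc (lmulm m a) b /\ rc a (rmulm m b)
    & rc a c -> rc c b -> forall w : dual R G,
        rc (rmulm (E w c) a) b /\ rc a (lmulm (E w c) b)].
Proof.
move=> E rc; split.
- exact: relatively_continuousD.
- exact: relatively_continuous_star.
- by move=> rab w m; exact: relatively_continuous_spectral.
- by move=> rac rcb w; exact: (relatively_continuous_fourier G_hausdorff mu_haar w rac rcb).
Qed.
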